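(* Let $\lambda>0$, $0<\nu\le 1$ and $0<u\le 1$. The probability generating function $\widehat{G}_{\nu}(u,t)=\sum_{k=0}^{\infty}u^{k}\,\widehat{p}_k^{\nu}(t)$ coincides with the solution to the fractional differential equation $$\frac{\partial^{2\nu}G(u,t)}{\partial t^{2\nu}}+2\lambda\frac{\partial^{\nu}G(u,t)}{\partial t^{\nu}}=\lambda^{2}(u-1)\,G(u,t)$$ subject to the initial condition $G(u,0)=1$ and the additional condition $\frac{\partial G}{\partial t}(u,0)=0$ for $\tfrac12<\nu\le 1$. Its explicit expression is $$\widehat{G}_{\nu}(u,t)=\frac{\sqrt{u}+1}{2\sqrt{u}}\,E_{\nu,1}\bigl(-\lambda(1-\sqrt{u})t^{\nu}\bigr)+\frac{\sqrt{u}-1}{2\sqrt{u}}\,E_{\nu,1}\bigl(-\lambda(1+\sqrt{u})t^{\nu}\bigr).$$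
   Context: For $k\ge 0$, $t>0$, $$\widehat{p}_k^{\nu}(t)=\lambda^{2k}t^{2k\nu}E_{\nu,2k\nu+1}^{2k+1}(-\lambda t^{\nu})+\lambda^{2k+1}t^{(2k+1)\nu}E_{\nu,(2k+1)\nu+1}^{2k+2}(-\lambda t^{\nu}),$$ which is the solution of $\frac{d^{2\nu}p_k}{dt^{2\nu}}+2\lambda\frac{d^{\nu}p_k}{dt^{\nu}}=-\lambda^2(p_k-p_{k-1})$, $k\ge 0$, with $p_{-1}(t)=0$, $p_0(0)=1$, $p_k(0)=0$ for $k\ge1$, and $p_k'(0)=0$ for all $k\ge 0$ when $\frac12<\nu\le1$. The generalized Mittag-Leffler function is $E_{\alpha,\beta}^{\gamma}(z)=\sum_{r=0}^{\infty}\frac{(\gamma)_r z^r}{r!\,\Gamma(\alpha r+\beta)}$ with $(\gamma)_r=\gamma(\gamma+1)\cdots(\gamma+r-1)$ for $r\ge1$, $(\gamma)_0=1$, and $E_{\alpha,\beta}(z)=E^{1}_{\alpha,\beta}(z)=\sum_{r=0}^\infty \frac{z^r}{\Gamma(\alpha r+\beta)}$. Fractional derivatives in $t$ of order $\mu>0$ (here $\mu=\nu$ and $\mu=2\nu$) are in the sense of Caputo: for $m\in\mathbb{N}$, $\frac{d^{\mu}}{dt^{\mu}}u(t)=\frac{1}{\Gamma(m-\mu)}\int_0^t\frac{1}{(t-s)^{1+\mu-m}}\frac{d^m}{ds^m}u(s)\,ds$ if $m-1<\mu<m$, and $\frac{d^{\mu}}{dt^{\mu}}u(t)=\frac{d^m}{dt^m}u(t)$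 if $\mu=m$. *)

(* Defs.v *)
From HB Require Import structures.
From mathcomp Require Import all_boot all_order all_algebra.
From mathcomp Require Import all_classical all_reals all_analysis.

Set Implicit Arguments.
Unset Strict Implicit.
Unset Printing Implicit Defensive.

Import Order.TTheory GRing.Theory Num.Theory.
Import numFieldNormedType.Exports.

Local Open Scope classical_set_scope.
Local Open Scope ring_scope.

Section Definitions.
Context {R : realType}.
Local Notation mu := (@lebesgue_measure R).

(* Euler's integral; meaningful for x > 0, the only case used below. *)
Definition Gamma (x : R) : R :=
  \int[mu]_(s in `]0, +oo[) (s `^ (x - 1) * expR (- s)).

Definition pochhammer (g : R) (r : nat) : R := \prod_(i < r) (g + i%:R).

Definition mittag_leffler3 (a b g z : R) : R :=
  limn (series (fun r : nat =>
    pochhammer g r * z ^+ r / (r`!%:R * Gamma (a * r%:R + b)))).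

Definition mittag_leffler (a b z : R) : R := mittag_leffler3 a b 1 z.

(* [is_caputo alpha f t v]: the Caputo derivative of order alpha of f exists at
   t > 0 and equals v. Being a relation, it records what the total operators
   [derive1n] and [Rintegral] do not: that the ordinary derivatives exist and
   that the integral converges absolutely. Only the values of f on the positive
   half-line matter. *)
Definition is_caputo (alpha : R) (f : R -> R) (t v : R) : Prop :=
  (exists m : nat,
    [/\ m%:R - 1 < alpha < m%:R,
        forall (i : nat) (s : R), (i < m)%N -> 0 < s < t ->
          derivable (derive1n i f) s 1,
        mu.-integrable `]0, t[
          (fun s => (((t - s) `^ (1 + alpha - m%:R))^-1 * derive1n m f s)%:E) &
        v = (Gamma (m%:R - alpha))^-1 *
            \int[mu]_(s in `]0, t[)
              (((t - s) `^ (1 + alpha - m%:R))^-1 * derive1n m f s)]) \/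
  (exists m : nat,
    [/\ alpha = m%:R,
        \forall s \near t, forall i : nat, (i < m)%N ->
          derivable (derive1n i f) s 1 &
        v = derive1n m f t]).

(* Since 0 `^ 0 = 1, the formula also gives the initial values at t = 0:
   1 for k = 0 and 0 for k > 0. *)
Definition phat (lambda nu : R) (k : nat) (t : R) : R :=
  lambda ^+ (2 * k) * t `^ ((2 * k)%:R * nu) *
    mittag_leffler3 nu ((2 * k)%:R * nu + 1) (2 * k + 1)%:R
      (- lambda * t `^ nu) +
  lambda ^+ (2 * k + 1) * t `^ ((2 * k + 1)%:R * nu) *
    mittag_leffler3 nu ((2 * k + 1)%:R * nu + 1) (2 * k + 2)%:R
      (- lambda * t `^ nu).

Definition Ghat_series (lambda nu u t : R) : R^nat :=
  series (fun k : nat => u ^+ k * phat lambda nu k t).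

Definition Ghat (lambda nu u t : R) : R := limn (Ghat_series lambda nu u t).

(* G stands for t |-> G(u, t), u being a parameter of the equation. The time
   domain is [0, +oo[, so the time derivative at 0 is a right derivative. *)
Definition is_solution (lambda nu u : R) (G : R -> R) : Prop :=
  [/\ {within `[0, +oo[, continuous G},
      forall t : R, 0 < t -> exists a b : R,
        [/\ is_caputo (2 * nu) G t a,
            is_caputo nu G t b &
            a + 2 * lambda * b = lambda ^+ 2 * (u - 1) * G t],
      G 0 = 1 &
      1 / 2 < nu -> h^-1 * (G h - G 0) @[h --> 0^'+] --> (0 : R)].

End Definitions.

(* Main.v *)
(* Write $v = \sqrt u$, $I^a$ for the Riemann-Liouville integral of order $a$ and
   $T_j$ for the $j$-th Mittag-Leffler term, so that $\hat p_k = T_{2k} + T_{2k+1}$.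
   The weights $w_j = u^{\lfloor j/2 \rfloor}$ satisfy
   $2 v w_j = (v + 1) v^j + (v - 1) (-v)^j$. Expanding each $T_j$ in powers of
   $x = \lambda t^\nu$, the coefficient of $x^n / \Gamma(n \nu + 1)$ in
   $\sum_j w_j T_j$ is $\sum_j w_j \binom{n}{j} (-1)^{n-j}$, which the binomial
   theorem evaluates; since it is bounded by $2^n$, dominated convergence of
   series allows the regrouping and gives the closed form.

   The closed form is an entire function of $t^\nu$, so it can be differentiated
   termwise; by Euler's beta integral its Caputo derivatives shift the coefficient
   sequence, which obeys the characteristic recurrence of the equation.

   For uniqueness, a solution is differentiable everywhere on the open half-line
   and the Caputo derivatives force its derivatives to be integrable near 0. By the
   fundamental theorem of calculus for everywhere differentiable functions with
   integrable derivative, it satisfies the Volterra equation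
   $G - 1 + 2 \lambda I^\nu (G - 1) + \lambda^2 (1 - u) I^{2\nu} G = 0$; the difference
   of two solutions vanishes because $I^a$ is a contraction for a sup norm with
   exponential weight. *)

Require Import Defs.
From HB Require Import structures.
From mathcomp Require Import all_boot all_order all_algebra.
From mathcomp Require Import all_classical all_reals all_analysis.
From mathcomp Require Import measurable_realfun ring lra.

Import Order.TTheory GRing.Theory Num.Theory.
Import numFieldNormedType.Exports.

Local Open Scope classical_set_scope.
Local Open Scope ring_scope.

(** * Affine substitutions in Lebesgue integrals *)

Section lebesgue_change_of_variables.
Context {R : realType}.
Local Notation mu := (@lebesgue_measure R).
Implicit Types (f : R -> \bar R) (c s : R).
Local Open Scope ereal_scope.

(** Scaled by [c], the push-forward of [mu] under the affine map agrees with [mu] on half-open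
    intervals, so uniqueness of Lebesgue measure identifies the two. *)
Lemma ge0_integral_affine f c s : (0 < c)%R -> measurable_fun [set: R] f ->
  (forall x, 0 <= f x) ->
  c%:E * \int[mu]_x f (c * x + s)%R = \int[mu]_x f x.
Proof.
move=> c0 mf f0.
pose phi : R -> measurableTypeR R := fun x => (c * x + s)%R.
have mphi : measurable_fun [set: R] phi.
  by apply: measurable_funD => //; apply: measurable_funM.
pose k : {nonneg R} := NngNum (ltW c0).
have E : \int[mscale k (pushforward mu phi)]_x f x = \int[mu]_x f x.
  move=> ?; apply: eq_measure_integral => A mA _ /=.
  apply/esym/lebesgue_measure_unique => //= _ [[a b]] _ <-.
  transitivity (c%:E * mu `]((a - s) / c)%R, ((b - s) / c)%R]%classic); last first.
    congr (_ * mu _); apply/seteqP; split => x /=; rewrite !in_itv /= ltr_pdivrMr //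
      ler_pdivlMr // /phi ltrBlDr lerBrDr mulrC //.
  rewrite !lebesgue_measure_itv /= !lte_fin.
  rewrite ltr_pM2r ?invr_gt0 // ltrD2r; case: ifPn => ab; last by rewrite mule0.
  rewrite -!EFinD -EFinM; congr EFin.
  have := lt0r_neq0 c0 => ?; by field.
rewrite -(E mphi) ge0_integral_mscale //= ge0_integral_pushforward //=.
Qed.

Lemma ge0_integral_shift f s : measurable_fun [set: R] f -> (forall x, 0 <= f x) ->
  \int[mu]_x f (x + s)%R = \int[mu]_x f x.
Proof.
move=> mf f0; rewrite -(ge0_integral_affine f 1 s) // mul1e.
by under [RHS]eq_integral do rewrite mul1r.
Qed.

Lemma ge0_integral_opp f : measurable_fun [set: R] f -> (forall x, 0 <= f x) ->
  \int[mu]_x f (- x)%R = \int[mu]_x f x.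
Proof.
move=> mf f0.
transitivity (\int[pushforward mu (-%R : R -> measurableTypeR R)]_x f x).
  by rewrite ge0_integral_pushforward.
apply: eq_measure_integral => //= A mA _; exact: lebesgue_measureN.
Qed.

Lemma ge0_integral_reflect f s : measurable_fun [set: R] f -> (forall x, 0 <= f x) ->
  \int[mu]_x f (s - x)%R = \int[mu]_x f x.
Proof.
move=> mf f0; rewrite -(ge0_integral_shift f s) //.
rewrite -(ge0_integral_opp (fun x => f (x + s)%R)) //.
  by under [RHS]eq_integral do rewrite addrC.
by apply: measurableT_comp => //; apply: measurable_funD.
Qed.

End lebesgue_change_of_variables.

(** * The power kernel and Euler's beta and gamma integrals *)

Section power_kernel.
Context {R : realType}.
Local Notation mu := (@lebesgue_measure R).
Implicit Types (a b c s t x : R).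

Lemma powRDgt0 x a b : 0 < x -> x `^ (a + b) = x `^ a * x `^ b.
Proof. by move=> x0; rewrite powRD // (gt_eqF x0) implybT. Qed.

(* The one-sided power $x_+^{a-1}$: with it the Riemann-Liouville integral
   becomes a convolution over the whole line. *)
Definition kpow a x : R := if 0 < x then x `^ (a - 1) else 0.

Lemma kpow_gt0E a x : 0 < x -> kpow a x = x `^ (a - 1).
Proof. by rewrite /kpow => ->. Qed.

Lemma kpow_le0 a x : x <= 0 -> kpow a x = 0.
Proof. by rewrite /kpow leNgt => /negbTE ->. Qed.

Lemma kpow_ge0 a x : 0 <= kpow a x.
Proof. by rewrite /kpow; case: ifP => // _; exact: powR_ge0. Qed.

Lemma kpow1 x : kpow 1 x = (0 < x)%R%:R.
Proof. by rewrite /kpow subrr powRr0; case: ifP. Qed.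

Lemma kpow_scale a c x : 0 < c -> kpow a (c * x) = c `^ (a - 1) * kpow a x.
Proof.
move=> c0; rewrite /kpow pmulr_rgt0 //; case: ifPn => x0; last by rewrite mulr0.
by rewrite powRM // ltW.
Qed.

Lemma kpow_patch a : kpow a = (fun x => x `^ (a - 1)) \_ `]0, +oo[.
Proof.
by apply/funext => x; rewrite patchE /kpow mem_setE in_itv /= andbT.
Qed.

Lemma measurable_kpow a : measurable_fun [set: R] (kpow a).
Proof.
rewrite kpow_patch; apply/(measurable_restrictT _ _).1 => //.
by apply: measurable_funTS; exact: measurable_powR.
Qed.

Lemma measurable_kpow_comp d (T : measurableType d) a (g : T -> R) :
  measurable_fun [set: T] g -> measurable_fun [set: T] (fun y => kpow a (g y)).
Proof. by move=> mg; apply: measurableT_comp => //; exact: measurable_kpow. Qed.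

(* Euler's integrals are first taken in [\bar R], so that Tonelli's theorem
   relates them before any of them is known to be finite. *)
Definition betaE a b : \bar R := (\int[mu]_x (kpow a (1 - x) * kpow b x)%:E)%E.

Lemma betaE_ge0 a b : (0 <= betaE a b)%E.
Proof. by apply: integral_ge0 => x _; rewrite lee_fin mulr_ge0 ?kpow_ge0. Qed.

(** The shift by [s] and the scaling by [t - s] produce Euler's beta integral; the exponent is the
    homogeneity degree [(a - 1) + (b - 1)] plus one from the measure. When [t <= s] the supports of
    the two kernels are disjoint and both sides vanish. *)
Lemma kpow_convolution a b s t :
  (\int[mu]_x (kpow a (t - x) * kpow b (x - s))%:E
   = betaE a b * (kpow (a + b) (t - s))%:E)%E.
Proof.
have mk d (u v : R) : measurable_fun [set: R] (fun x => kpow d (u - x)).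
  by apply: measurable_kpow_comp; apply: measurable_funB.
have mk' d (u v : R) : measurable_fun [set: R] (fun x => kpow d (x - u)).
  by apply: measurable_kpow_comp; apply: measurable_funB.
rewrite -(ge0_integral_shift _ s); last 2 first.
- by apply/measurable_EFinP; apply: measurable_funM; [exact: mk|exact: mk'].
- by move=> x; rewrite lee_fin mulr_ge0 ?kpow_ge0.
under eq_integral => x _ do rewrite addrK (addrC x) opprD addrA.
have [ts0|ts0] := leP (t - s) 0.
  rewrite (kpow_le0 (a + b)) // mule0; apply: integral0_eq => x _.
  have [x0|x0] := leP x 0; first by rewrite [kpow b x]kpow_le0 // mulr0.
  by rewrite kpow_le0 ?mul0r // subr_le0 (le_trans ts0) // ltW.
rewrite -(ge0_integral_affine _ (t - s) 0) //; last 2 first.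
- by apply/measurable_EFinP; apply: measurable_funM;
    [exact: mk|exact: measurable_kpow].
- by move=> x; rewrite lee_fin mulr_ge0 ?kpow_ge0.
under eq_integral => x _.
  rewrite addr0 -[X in kpow a (X - _)]mulr1 -mulrBr !kpow_scale //.
  rewrite mulrACA EFinM.
  over.
rewrite ge0_integralZl //; last 3 first.
- by apply/measurable_EFinP; apply: measurable_funM;
    [exact: mk|exact: measurable_kpow].
- by move=> x _; rewrite lee_fin mulr_ge0 ?kpow_ge0.
- by rewrite lee_fin mulr_ge0 ?powR_ge0.
rewrite muleA muleC -EFinM; congr (_ * _%:E)%E.
rewrite kpow_gt0E // -{1}(powRr1 (ltW ts0)) -!powRDgt0 //; congr (_ `^ _).
by ring.
Qed.

Definition gammaE a : \bar R := (\int[mu]_x (kpow a x * expR (- x))%:E)%E.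

Lemma GammaE a : Gamma a = fine (gammaE a).
Proof.
rewrite /Gamma Rintegral_mkcond /Rintegral /gammaE; congr fine.
apply: eq_integral => x _; rewrite patchE mem_setE in_itv /= andbT /kpow.
by case: ifPn => _; rewrite ?mul0r.
Qed.

Lemma measurable_expRN : measurable_fun [set: R] (fun x : R => expR (- x)).
Proof. by apply: measurableT_comp => //; exact: measurable_expR. Qed.

Lemma gammaE_ge0 a : (0 <= gammaE a)%E.
Proof.
by apply: integral_ge0 => x _; rewrite lee_fin mulr_ge0 ?kpow_ge0 ?expR_ge0.
Qed.

(** The product is a double integral over [r] and [y]. Substituting [x = r + y] leaves the
    exponential factor [expR (- x)], and after Tonelli's exchange the integral over [r] is a
    convolution of power kernels. *)
Lemma gammaEM a b : (gammaE a * gammaE b = betaE b a * gammaE (b + a))%E.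
Proof.
have mg d : measurable_fun [set: R] (fun x => (kpow d x * expR (- x))%:E).
  apply/measurable_EFinP; apply: measurable_funM; first exact: measurable_kpow.
  exact: measurable_expRN.
have g0 d x : (0 <= (kpow d x * expR (- x))%:E)%E.
  by rewrite lee_fin mulr_ge0 ?kpow_ge0 ?expR_ge0.
rewrite muleC /gammaE -ge0_integralZl //; [|exact: mg|exact: gammaE_ge0].
pose h (z : R * R) := (kpow a z.1 * kpow b (z.2 - z.1) * expR (- z.2))%:E.
have mh : measurable_fun [set: R * R] h.
  apply/measurable_EFinP; apply: measurable_funM; first apply: measurable_funM.
  - by apply: measurable_kpow_comp.
  - by apply: measurable_kpow_comp; apply: measurable_funB.
  - apply: (measurableT_comp (f := fun y : R => expR (- y))) => //.
    exact: measurable_expRN.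
have h0 z : (0 <= h z)%E by rewrite lee_fin !mulr_ge0 ?kpow_ge0 ?expR_ge0.
transitivity (\int[mu]_r \int[mu]_x h (r, x))%E.
  apply: eq_integral => r _; rewrite -/(gammaE b) muleC.
  rewrite /gammaE -(ge0_integral_shift _ (- r)) // -ge0_integralZl //; last first.
    by apply: (measurableT_comp (mg b)); apply: measurable_funD.
  apply: eq_integral => x _; rewrite /h -EFinM /=; congr EFin.
  by rewrite opprB mulrACA -expRD addKr.
rewrite fubini_tonelli //.
rewrite -ge0_integralZl //; [|exact: mg|exact: betaE_ge0].
apply: eq_integral => x _.
under eq_integral => r _ do
  rewrite /h /= mulrC EFinM (mulrC (kpow a _)).
rewrite ge0_integralZl //; last 2 first.
- have mk : measurable_fun [set: R] (fun r => kpow b (x - r) * kpow a r).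
    apply: measurable_funM; last exact: measurable_kpow.
    by apply: measurable_kpow_comp; apply: measurable_funB.
  by apply/measurable_EFinP.
- by move=> r _; rewrite lee_fin mulr_ge0 ?kpow_ge0.
under eq_integral => r _ do rewrite -{2}(subr0 r).
by rewrite kpow_convolution subr0 muleC -muleA EFinM.
Qed.

(** Monotone convergence along the intervals [[1 / (n + 1), 1]]: for [a < 1] the integrand is
    unbounded near 0, and the fundamental theorem is applied away from it. *)
Lemma integral_powR_01 a : 0 < a ->
  (\int[mu]_(x in `]0%R, 1%R]) (x `^ (a - 1))%:E = (a^-1)%:E)%E.
Proof.
move=> a0.
pose F n := [set` `[(n.+1%:R)^-1 : R, 1]].
have -> : `]0%R, 1%R]%classic = \bigcup_n F n :> set R.
  apply/seteqP; split => x /=.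
    rewrite in_itv /= => /andP[x0 x1].
    have [n Hn] := ltr_add_invr x0.
    exists n => //; rewrite /F /= in_itv /= x1 andbT ltW //.
    by move: Hn; rewrite add0r.
  case=> n _; rewrite /F /= !in_itv /= => /andP[nx ->]; rewrite andbT.
  by rewrite (lt_le_trans _ nx).
have mp (D : set R) : measurable_fun D (fun x : R => (x `^ (a - 1))%:E).
  by apply/measurable_EFinP; apply: measurable_funTS; exact: measurable_powR.
have H : (\int[mu]_(x in F n) (x `^ (a - 1))%:E)%E @[n --> \oo]
    --> (\int[mu]_(x in \bigcup_n F n) (x `^ (a - 1))%:E)%E.
  apply: ge0_nondecreasing_set_cvg_integral => //.
  - move=> n m nm; rewrite subsetEset => x; rewrite /F /= !in_itv /= => /andP[nx ->].
    by rewrite andbT (le_trans _ nx) // lef_pV2 ?posrE // ler_nat.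
  - by move=> n; exact: measurable_itv.
  - by move=> n; exact: mp.
  - by move=> n x _; rewrite lee_fin powR_ge0.
apply/esym/(cvg_unique _ _ H) => //.
suff -> : (fun n => \int[mu]_(x in F n) (x `^ (a - 1))%:E)%E =
    (fun n => ((1 - ((n.+1%:R)^-1) `^ a) / a)%:E).
  apply: cvg_EFin; first exact: nearW.
  rewrite -[X in _ --> X]mul1r -[X in X * _]subr0.
  apply: cvgMl; apply: cvgB; first exact: cvg_cst.
  apply: (cvg_at_rightP (fun x => x `^ a) 0 0).1; first exact: powR_cvg0.
  by split=> [n|]; [rewrite invr_gt0|exact: cvg_harmonic].
apply/funext => n.
(* For [n = 0] the interval is the point 1, while the fundamental theorem asks for distinct end
   points. *)
case: n => [|n].
  by rewrite /F invr1 set_itv1 integral_set1 powR1 subrr mul0r.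
have n1 : (n.+2%:R)^-1 < 1 :> R by rewrite invf_lt1 // ltr1n.
have n0 : 0 < (n.+2%:R)^-1 :> R by rewrite invr_gt0.
pose G x := x `^ a / a.
have dG x : 0 < x -> is_derive x 1 G (x `^ (a - 1)).
  move=> x0; apply: DeriveDef.
    by apply: derivableM => //; apply: derivable_powR; rewrite in_itv /= x0.
  rewrite deriveM //; last by apply: derivable_powR; rewrite in_itv /= x0.
  rewrite derive_cst scaler0 add0r -derive1E powR_derive1 ?in_itv /= ?x0 //.
  by rewrite /GRing.scale /= mulrA mulVf ?mul1r // gt_eqF.
rewrite (continuous_FTC2 (F := G) n1).
- by rewrite /G powR1 -EFinB mulrBl.
- apply: continuous_in_subspaceT => x.
  rewrite inE /= in_itv /= => /andP[nx _].
  apply: differentiable_continuous; apply/derivable1_diffP.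
  by apply: derivable_powR; rewrite in_itv /= andbT (lt_le_trans _ nx).
- split.
  + by move=> x; rewrite in_itv /= => /andP[nx _]; have [] := dG x (lt_trans n0 nx).
  + apply: cvg_at_right_filter.
    by apply: differentiable_continuous; apply/derivable1_diffP; have [] := dG _ n0.
  + apply: cvg_at_left_filter.
    by apply: differentiable_continuous; apply/derivable1_diffP; have [] := dG _ ltr01.
- move=> x; rewrite in_itv /= => /andP[nx _]; rewrite derive1E.
  by have [_ ->] := dG x (lt_trans n0 nx).
Qed.

Lemma betaE1 a : 0 < a -> betaE 1 a = (a^-1)%:E.
Proof.
move=> a0; rewrite -integral_powR_01 // -integral_itv_bndo_bndc; last first.
  by apply/measurable_EFinP; apply: measurable_funTS; exact: measurable_powR.
rewrite [RHS]integral_mkcond; apply: eq_integral => x _.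
rewrite patchE mem_setE in_itv /= kpow1 subr_gt0 /kpow.
by case: ltP => x0; case: ltP => x1 /=; rewrite ?mul0r ?mulr0 ?mul1r.
Qed.

Lemma gammaE_one : gammaE 1 = 1%E.
Proof.
rewrite -(integral_exponential_pdf (ltr01 : (0 : R) < 1)) /gammaE.
rewrite (_ : exponential_pdf 1 = (fun x : R => expR (- x)) \_ `[0, +oo[%classic); last first.
  by apply/funext => x; rewrite /exponential_pdf !patchE mul1r; case: ifP; rewrite // mulN1r.
rewrite [RHS](_ : _ = \int[mu]_x ((EFin \o (fun x0 : R => expR (- x0))) \_ `[0%R, +oo[) x)%E; last first.
  by apply: eq_integral => x _; rewrite restrict_EFin.
rewrite -[RHS]integral_mkcond -integral_itv_obnd_cbnd; last first.
  by apply/measurable_EFinP; apply: measurable_funTS; exact: measurable_expRN.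
rewrite [RHS]integral_mkcond; apply: eq_integral => x _.
rewrite patchE mem_setE in_itv /= andbT kpow1; case: ifP => _ /=; rewrite ?mul1r ?mul0r //.
Qed.

(** Instead of an integration by parts, this is the product formula for [gammaE a * gammaE 1], where
    the beta integral is [1 / a] and [gammaE 1 = 1]. *)
Lemma gammaE_rec a : 0 < a -> gammaE (a + 1) = (a%:E * gammaE a)%E.
Proof.
move=> a0; have := gammaEM a 1; rewrite gammaE_one mule1 (betaE1 _ a0) (addrC 1 a) => ->.
by rewrite muleA -EFinM mulfV ?mul1e // gt_eqF.
Qed.

(** Finiteness at the positive integers comes from the recurrence, then at every [b >= 1] from
    [x^(b-1) <= 1 + x^n] with [n] large; the recurrence finally carries it from [a + 1] back to
    [a]. *)
Lemma gammaE_lty a : 0 < a -> (gammaE a < +oo)%E.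
Proof.
have gn (n : nat) : (gammaE n.+1%:R < +oo)%E.
  elim: n => [|n IH]; first by rewrite gammaE_one ltry.
  rewrite -[n.+2%:R]natr1 gammaE_rec // lte_mul_pinfty ?lee_fin //.
have mg d : measurable_fun [set: R] (fun x => (kpow d x * expR (- x))%:E).
  apply/measurable_EFinP; apply: measurable_funM; first exact: measurable_kpow.
  exact: measurable_expRN.
have g0 d x : (0 <= (kpow d x * expR (- x))%:E)%E.
  by rewrite lee_fin mulr_ge0 ?kpow_ge0 ?expR_ge0.
have g1 b : 1 <= b -> (gammaE b < +oo)%E.
  move=> b1; pose n := Num.bound b.
  have bn : b <= n.+1%:R.
    rewrite (@le_trans _ _ n%:R) ?ler_nat //.
    by have := archi_boundP (le_trans ler01 b1) => /ltW.
  apply: (@le_lt_trans _ _ (gammaE 1 + gammaE n.+1%:R)%E); last first.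
    by rewrite gammaE_one lte_add_pinfty ?ltry.
  rewrite /gammaE -ge0_integralD //; try exact: mg.
  apply: ge0_le_integral => //; try exact: mg.
  - by apply: emeasurable_funD; exact: mg.
  - move=> x _; rewrite -EFinD lee_fin -mulrDl ler_wpM2r ?expR_ge0 //.
    have [x0|x0] := leP x 0; first by rewrite !kpow_le0 ?addr0.
    rewrite kpow1 x0 kpow_gt0E // kpow_gt0E //.
    have [x1|x1] := leP x 1.
      rewrite (@le_trans _ _ (x `^ 0)) ?powRr0 ?lerDl ?powR_ge0 //.
      by rewrite -[leRHS](powRr0 x) ger_powR ?x0 // subr_ge0.
    rewrite (@le_trans _ _ (x `^ (n.+1%:R - 1))) ?lerDr //.
    by rewrite ler_powR ?(ltW x1) // lerD2r.
move=> a0; have := g1 (a + 1); rewrite lerDr => /(_ (ltW a0)).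
rewrite gammaE_rec //; have := gammaE_ge0 a.
case: (gammaE a) => [r| |] //= _; rewrite ?ltry //.
by rewrite gt0_muley // ?lte_fin // ltxx.
Qed.

(** Only the mass beyond [A] is kept, where [y^x >= A^x]. Since [A] is free, [Gamma (x + 1)]
    outgrows every exponential in [x]; the case [A = 1] gives positivity. *)
Lemma gammaE_ge x A : 0 <= x -> 0 < A -> ((A `^ x * expR (- A))%:E <= gammaE (x + 1))%E.
Proof.
move=> x0 A0; rewrite -[leLHS]mule1 -gammaE_one.
have mg d : measurable_fun [set: R] (fun x => (kpow d x * expR (- x))%:E).
  apply/measurable_EFinP; apply: measurable_funM; first exact: measurable_kpow.
  exact: measurable_expRN.
have g0 d y : (0 <= (kpow d y * expR (- y))%:E)%E.
  by rewrite lee_fin mulr_ge0 ?kpow_ge0 ?expR_ge0.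
rewrite /gammaE -(ge0_integral_shift (fun y => (kpow 1 y * expR (- y))%:E) (- A)) //.
have mg' : measurable_fun [set: R] (fun y => (kpow 1 (y - A) * expR (- (y - A)))%:E).
  by apply: (measurableT_comp (mg 1)); apply: measurable_funD.
rewrite -ge0_integralZl ?lee_fin ?mulr_ge0 ?powR_ge0 ?expR_ge0 //.
apply: ge0_le_integral => //.
- by move=> y _; rewrite mule_ge0 // lee_fin mulr_ge0 ?powR_ge0 ?expR_ge0.
- by apply: measurable_funeM; exact: mg'.
- exact: mg.
- move=> y _; rewrite -EFinM lee_fin kpow1 subr_gt0.
  case: ltP => [Ay|_] /=; last by rewrite mul0r mulr0 mulr_ge0 ?kpow_ge0 ?expR_ge0.
  rewrite mul1r -mulrA -expRD opprB addKr ler_wpM2r ?expR_ge0 //.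
  have y0 := lt_trans A0 Ay.
  by rewrite kpow_gt0E // addrK ge0_ler_powR ?nnegrE // ltW.
Qed.

Lemma GammaEFin a : 0 < a -> gammaE a = (Gamma a)%:E.
Proof.
by move=> a0; rewrite GammaE fineK // ge0_fin_numE ?gammaE_ge0 // gammaE_lty.
Qed.

Lemma Gamma_rec a : 0 < a -> Gamma (a + 1) = a * Gamma a.
Proof.
move=> a0; apply: EFin_inj; rewrite EFinM -!GammaEFin ?addr_gt0 //.
exact: gammaE_rec.
Qed.

Lemma Gamma_one : Gamma (1 : R) = 1.
Proof. by rewrite GammaE gammaE_one. Qed.

Lemma Gamma_ge x A : 0 <= x -> 0 < A -> A `^ x * expR (- A) <= Gamma (x + 1).
Proof.
move=> x0 A0; rewrite -lee_fin -GammaEFin ?gammaE_ge //.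
by rewrite ltr_wpDl.
Qed.

Lemma Gamma_gt0 a : 0 < a -> 0 < Gamma a.
Proof.
move=> a0; have := Gamma_ge a 1 (ltW a0) ltr01.
rewrite Gamma_rec // powR1 mul1r => H.
rewrite -(pmulr_rgt0 _ a0); apply: lt_le_trans H; exact: expR_gt0.
Qed.

Lemma betaEFin a b : 0 < a -> 0 < b ->
  betaE a b = (Gamma a * Gamma b / Gamma (a + b))%:E.
Proof.
move=> a0 b0; have ab0 : 0 < a + b by rewrite addr_gt0.
have := gammaEM b a; rewrite !GammaEFin // -EFinM.
have := Gamma_gt0 _ ab0; move: (Gamma (a + b)) => g g0.
case: (betaE a b) (betaE_ge0 a b) => [r| |] //= _.
- by rewrite -EFinM => -[]; rewrite (mulrC (Gamma b)) => ->; rewrite mulfK ?gt_eqF.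
- by rewrite gt0_mulye.
Qed.

End power_kernel.

(** * Riemann-Liouville integrals and their semigroup law *)

Section fractional_integral.
Context {R : realType}.
Local Notation mu := (@lebesgue_measure R).
Implicit Types (f g : R -> R) (a b c s t : R).

Definition kint a f t (x : R) : R := kpow a (t - x) * f x.

(** For [f] vanishing on the negative half-line this is the Riemann-Liouville integral of order [a]
    based at 0; in general its base point is minus infinity. *)
Definition fint a f t : R := (Gamma a)^-1 * \int[mu]_x kint a f t x.

Definition kintegrable a f t := mu.-integrable [set: R] (EFin \o kint a f t).

Lemma measurable_kpow_sub a t : measurable_fun [set: R] (fun x : R => kpow a (t - x)).
Proof. by apply: measurable_kpow_comp; apply: measurable_funB. Qed.

Lemma measurable_kint a f t : measurable_fun [set: R] f ->
  measurable_fun [set: R] (kint a f t).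
Proof. by move=> mf; apply: measurable_funM => //; exact: measurable_kpow_sub. Qed.

Lemma kint_ge a f t x : t <= x -> kint a f t x = 0.
Proof. by move=> tx; rewrite /kint kpow_le0 ?mul0r // subr_le0. Qed.

Lemma kintegrableD a f g t : kintegrable a f t -> kintegrable a g t ->
  kintegrable a (f \+ g) t.
Proof.
move=> fi gi; have := integrableD measurableT fi gi.
by apply: eq_integrable => // x _; rewrite /= /kint mulrDr EFinD.
Qed.

Lemma kintegrableZ a c f t : kintegrable a f t -> kintegrable a (fun x => c * f x) t.
Proof.
move=> fi; have := integrableZl measurableT c fi.
by apply: eq_integrable => // x _; rewrite /= /kint mulrCA EFinM.
Qed.

Lemma fintD a f g t : kintegrable a f t -> kintegrable a g t ->
  fint a (f \+ g) t = fint a f t + fint a g t.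
Proof.
move=> fi gi; rewrite /fint -mulrDr -RintegralD //; congr (_ * _).
by apply: eq_Rintegral => x _; rewrite /kint mulrDr.
Qed.

Lemma fintZ a c f t : kintegrable a f t ->
  fint a (fun x => c * f x) t = c * fint a f t.
Proof.
move=> fi; rewrite /fint [RHS]mulrCA; congr (_ * _); rewrite -RintegralZl //.
by apply: eq_Rintegral => x _; rewrite /kint mulrCA.
Qed.

(** Fubini on the plane, where integrating out the middle variable is a convolution of power
    kernels. Integrability of the order [b] integrand is asked below [t], because the outer kernel
    vanishes from [t] on. *)
Lemma kint_semigroup a b f t : 0 < a -> 0 < b ->
  measurable_fun [set: R] f ->
  (forall x, x < t -> kintegrable b f x) -> kintegrable (a + b) f t ->
  kintegrable a (fint b f) t /\ fint a (fint b f) t = fint (a + b) f t.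
Proof.
move=> a0 b0 mf bi abi.
pose h (z : R * R) := (kpow a (t - z.1) * kint b f z.1 z.2)%:E.
have mh : measurable_fun [set: R * R] h.
  apply/measurable_EFinP; apply: measurable_funM.
    by apply: measurable_kpow_comp; apply: measurable_funB.
  apply: measurable_funM; first by apply: measurable_kpow_comp; apply: measurable_funB.
  exact: measurableT_comp.
have mk' s : measurable_fun [set: R] (fun x => kpow a (t - x) * kpow b (x - s)).
  apply: measurable_funM; first exact: measurable_kpow_sub.
  by apply: measurable_kpow_comp; apply: measurable_funB.
have G0 c : 0 < c -> Gamma c != 0 by move=> c0; rewrite gt_eqF // Gamma_gt0.
set B := Gamma a * Gamma b / Gamma (a + b).
have B0 : 0 <= B by rewrite divr_ge0 ?mulr_ge0 // ltW // Gamma_gt0 // addr_gt0.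
(* Integrating absolute values over [x] first yields [B] times [|kint (a + b) f t s|], whose
   integral over [s] is finite by hypothesis. *)
have hi : (mu \x mu)%E.-integrable [set: R * R] h.
  apply/integrable21ltyP => //.
  rewrite (_ : (fun _ => _) = (fun s => B%:E * `|(kint (a + b) f t s)%:E|)%E); last first.
    apply/funext => s /=.
    under eq_integral => x _.
      rewrite /kint mulrA normrM mulrC EFinM [`|kpow _ _ * _|]ger0_norm ?mulr_ge0 ?kpow_ge0 //.
      over.
    rewrite ge0_integralZl //=; last 2 first.
    - by apply/measurable_EFinP; exact: mk'.
    - by move=> x _; rewrite lee_fin mulr_ge0 ?kpow_ge0.
    rewrite kpow_convolution betaEFin // -!EFinM /kint normrM.
    by rewrite [in RHS](ger0_norm (kpow_ge0 _ _)) mulrCA mulrA mulrAC mulrA.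
  rewrite ge0_integralZl //; last first.
    by apply: measurableT_comp => //; apply/measurable_EFinP; exact: measurable_kint.
  apply: lte_mul_pinfty => //.
  by have /integrableP[] := abi.
have FE x : fubini_F mu h x = (kpow a (t - x) * (Gamma b * fint b f x))%:E.
  rewrite /fubini_F /h /=; have [tx|xt] := leP t x.
    rewrite kpow_le0 ?subr_le0 // mul0r.
    by apply: integral0_eq => y _; rewrite mul0r.
  under eq_integral do rewrite EFinM.
  rewrite integralZl //; last exact: bi.
  rewrite /fint mulVKf ?G0 // EFinM; congr (_ * _)%E.
  rewrite /Rintegral fineK //; apply: integrable_fin_num => //; exact: bi.
have Fi := integrable_fubini_F hi.
have ai : kintegrable a (fint b f) t.
  have := integrableZl measurableT (Gamma b)^-1 Fi.
  apply: eq_integrable => // x _.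
  transitivity (((Gamma b)^-1)%:E * (kpow a (t - x) * (Gamma b * fint b f x))%:E)%E.
    by congr (_ * _)%E; exact: FE.
  rewrite /= /kint -EFinM; congr EFin.
  by rewrite mulrCA mulKf ?G0.
split => //.
have := Fubini hi.
rewrite (_ : (fun x => \int[mu]_y h (x, y))%E =
             (fun x => (Gamma b)%:E * (kint a (fint b f) t x)%:E)%E); last first.
  by apply/funext => x; rewrite [LHS]FE -EFinM mulrCA.
rewrite (_ : (fun y => \int[mu]_x h (x, y))%E =
             (fun y => B%:E * (kint (a + b) f t y)%:E)%E); last first.
  apply/funext => s; rewrite /h /=.
  under eq_integral => x _ do rewrite /kint mulrA mulrC EFinM.
  rewrite integralZl //; last first.
    apply/integrableP; split; first by apply/measurable_EFinP; exact: mk'.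
    under eq_integral => x _ do rewrite /= ger0_norm ?mulr_ge0 ?kpow_ge0 //.
    by rewrite kpow_convolution betaEFin // -EFinM ltry.
  rewrite kpow_convolution betaEFin // -!EFinM /kint.
  by rewrite mulrC mulrA.
rewrite !integralZl //.
have fk c g x : kintegrable c g x ->
  (\int[mu]_y (kint c g x y)%:E)%E = (\int[mu]_y (kint c g x y))%:E.
  by move=> ?; rewrite /Rintegral fineK //; exact: integrable_fin_num.
rewrite !fk // -!EFinM => -[] E.
rewrite /fint -/(fint b f) [X in _^-1 * X](_ : _ = (Gamma b)^-1 * (B * \int[mu]_x kint (a + b) f t x)).
  rewrite /B; move: (\int[mu]_x _) (Gamma a) (Gamma b) (Gamma _) (G0 _ a0) (G0 _ b0) (G0 _ (addr_gt0 a0 b0)).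
  by move=> I x y z x0 y0 z0; field; rewrite x0 y0 z0.
by rewrite -E mulKf ?G0.
Qed.

(** [kpow 1] is an indicator, so the last clause is integrability on bounded intervals of the
    positive axis. *)
Definition locally_integrable_pos f :=
  [/\ measurable_fun [set: R] f, forall x, x <= 0 -> f x = 0 &
      forall t, kintegrable 1 f t].

(** For [a >= 1] the kernel is bounded where it counts: [(t - x)^(a-1) <= t^(a-1)] for
    [0 < x < t]. *)
Lemma locint_kintegrable a f t : 1 <= a -> locally_integrable_pos f ->
  kintegrable a f t.
Proof.
move=> a1 [mf f0 fi].
have := integrableZl measurableT (`|t| `^ (a - 1)) (fi t).
apply: le_integrable => //.
  by apply/measurable_EFinP; exact: measurable_kint.
move=> x _; rewrite /= lee_fin /kint !normrM [`| _ `^ _ |]ger0_norm ?powR_ge0 //.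
have [x0|x0] := leP x 0; first by rewrite f0 // normr0 !mulr0.
have [tx|xt] := leP t x; first by rewrite !kpow_le0 ?subr_le0 // normr0 mul0r mulr0.
rewrite mulrA ler_wpM2r // kpow1 subr_gt0 xt normr1 mulr1 kpow_gt0E ?subr_gt0 //.
rewrite [`| _ `^ _ |]ger0_norm ?powR_ge0 // ge0_ler_powR ?subr_ge0 ?nnegrE //; last first.
  by rewrite (le_trans _ (ler_norm _)) // gerBl ltW.
by rewrite subr_ge0 ltW.
Qed.

End fractional_integral.

(** * Fundamental theorem of calculus for everywhere differentiable functions *)

Section derivative_FTC.
Context {R : realType}.
Local Notation mu := (@lebesgue_measure R).

(** Real induction: the supremum of the points where [D] is at most [D a] is itself such a point and
    cannot lie below [b]. The hypothesis compares points on either side of [x], which is what a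
    derivative at [x] controls. *)
Lemma locally_nonincreasing (D : R -> R) (a b : R) : a <= b ->
  (forall x, a <= x <= b -> exists2 d, 0 < d & forall u v,
     a <= u -> v <= b -> u <= x <= v -> x - d < u -> v < x + d -> D v <= D u) ->
  D b <= D a.
Proof.
move=> ab loc.
pose S := [set x | a <= x <= b /\ D x <= D a].
have Sa : S a by rewrite /S /= lexx ab.
have Sb : has_ubound S by exists b => x [/andP[]].
have supS : has_sup S by split; [exists a|].
set s := sup S.
have sa : a <= s by apply: ub_le_sup.
have sb : s <= b by apply: ge_sup; [exists a|move=> x [/andP[]]].
have [|d d0 Hd] := loc s; first by rewrite sa sb.
have [x [xab Dx] sx] := sup_adherent d0 supS.
have xs : x <= s by apply: ub_le_sup => //; split.
have [ax xb] := andP xab.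
have Ds : D s <= D a.
  apply: le_trans Dx; apply: Hd => //; first by rewrite xs lexx.
  by rewrite ltrDl.
have [bs|sb'] := leP b s.
  by have <- : s = b by apply/le_anti; rewrite sb bs.
pose v := Num.min b (s + d / 2).
have sv : s < v by rewrite lt_min sb' ltrDl divr_gt0.
suff /(ub_le_sup Sb) : S v by rewrite leNgt sv.
split; first by rewrite (le_trans sa (ltW sv)) ge_min lexx.
apply: le_trans Ds; apply: Hd => //.
- by rewrite ge_min lexx.
- by rewrite lexx ltW.
- by rewrite ltrBlDr ltrDl.
- by rewrite gt_min; apply/orP; right; rewrite ltrD2l ltr_pdivrMr // ltr_pMr // ltr1n.
Qed.

Lemma integrable_cst_itv (a b k : R) : mu.-integrable `]a, b] (fun=> k%:E).
Proof.
apply/integrableP; split; first exact: measurable_cst.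
rewrite integral_cst //= lebesgue_measure_itv /=.
by case: ifP => _; rewrite ?mule0 // -EFinD -EFinM ltry.
Qed.

Lemma derivable_slope (f : R -> R) (x w e : R) : is_derive x 1 f w -> 0 < e ->
  exists2 d, 0 < d & forall y, `|y - x| < d -> `|f y - f x - w * (y - x)| <= e * `|y - x|.
Proof.
move=> [df fw] e0.
have : h^-1 *: (f (h *: 1 + x) - f x) @[h --> 0^'] --> w by rewrite -fw.
move/cvgrPdist_le => /(_ _ e0)[d /= d0 Hd]; exists d => // y yx.
have [->|yx0] := eqVneq y x; first by rewrite !subrr mulr0 subr0 normr0 mulr0.
have h0 : y - x != 0 by rewrite subr_eq0.
have := Hd (y - x); rewrite /ball_ /= sub0r normrN => /(_ yx h0).
rewrite /GRing.scale /= mulr1 subrK => H.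
rewrite -[X in `|X|](_ : (y - x) * - (w - (y - x)^-1 * (f y - f x)) = _).
  by rewrite normrM normrN mulrC ler_wpM2r.
by rewrite opprB mulrBr mulVKf // (mulrC w).
Qed.

(* Vitali-Caratheodory: on the level sets where [W] lies in a short interval,
   an error supported on a thin open neighbourhood makes [W + psi] almost lower
   semicontinuous. *)
Lemma vitali_caratheodory (W : R -> R) (A : set R) (e : R) :
  measurable A -> (mu A < +oo)%E -> 0 < e ->
  mu.-integrable [set: R] (EFin \o W) ->
  exists psi : R -> \bar R, [/\ measurable_fun [set: R] psi,
    forall x, (0 <= psi x)%E, (\int[mu]_x psi x <= e%:E)%E &
    forall x, A x -> exists2 d, 0 < d & forall y, `|y - x| < d ->
      ((W x - e)%:E <= (W y)%:E + psi y)%E].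
Proof.
move=> mA Afin e0 Wi.
have mW : measurable_fun [set: R] W by apply/measurable_EFinP; exact: measurable_int Wi.
(* The levels are the integer multiples of [e], enumerated through [unpickle]; an undecodable index
   repeats the level 0. *)
pose c (n : nat) : R := e * (odflt 0%Z (unpickle n : option int))%:~R.
pose E n := A `&` (W @^-1` [set` `[c n, c n + e[]).
have mE n : measurable (E n).
  by apply: measurableI => //; rewrite -[X in measurable X]setTI; exact: mW.
have Efin n : (mu (E n) < +oo)%E.
  by apply: le_lt_trans Afin; apply: le_measure; [rewrite inE; exact: mE|by rewrite inE|exact: subIsetl].
pose r (n : nat) : R := e / (2 ^ n.+1)%:R.
have r0 n : 0 < r n by rewrite divr_gt0 // ltr0n expn_gt0.
have HV n : exists V : set R, [/\ open V, E n `<=` V &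
    (\int[mu]_(y in V `\` E n) (`|W y| + `|c n|)%:E <= (r n)%:E)%E].
  have r20 : 0 < r n / 2 by rewrite divr_gt0.
  have [d [d0 Hd]] := integral_normr_continuous Wi r20.
  (* The first bound makes the integral of [|W|] over the excess small, by absolute continuity; the
     second does so for the constant [|c n|]. *)
  pose d' := Num.min d (r n / 2 / (`|c n| + 1)).
  have c10 : 0 < `|c n| + 1 by rewrite ltr_wpDl.
  have d'0 : 0 < d' by rewrite lt_min d0 divr_gt0.
  have [V [oV EV VE]] := lebesgue_regularity_outer (mE n) (Efin n) d'0.
  exists V; split => //.
  have mV : measurable (V `\` E n) by apply: measurableD => //; exact: open_measurable.
  have iW : mu.-integrable (V `\` E n) (EFin \o (fun y => `|W y|)).
    by apply: integrableS (integrable_norm Wi).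
  under eq_integral do rewrite EFinD.
  rewrite ge0_integralD //; last first.
    by apply/measurable_EFinP; apply: measurableT_comp => //; apply: measurable_funTS.
  rewrite [leRHS](_ : _ = (r n / 2)%:E + (r n / 2)%:E)%E; last first.
    by rewrite -EFinD -splitr.
  apply: leeD.
    have VEd : (mu (V `\` E n) < d%:E)%E.
      by apply: (lt_le_trans VE); rewrite lee_fin ge_min lexx.
    have := ltW (Hd _ mV VEd).
    by rewrite -lee_fin /Rintegral fineK ?integrable_fin_num.
  rewrite integral_cst //.
  apply: (@le_trans _ _ (`|c n|%:E * (r n / 2 / (`|c n| + 1))%:E)%E).
    rewrite lee_wpmul2l ?lee_fin // (le_trans (ltW VE)) // lee_fin ge_min lexx orbT //.
  rewrite -EFinM lee_fin mulrCA ger_pMr // ler_pdivrMr // mul1r lerDl //.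
pose V n : set R := projT1 (cid (HV n)).
have VP n : [/\ open (V n), E n `<=` V n &
    (\int[mu]_(y in V n `\` E n) (`|W y| + `|c n|)%:E <= (r n)%:E)%E].
  by rewrite /V; case: cid.
pose p n : R -> \bar R := (fun y : R => (`|W y| + `|c n|)%:E) \_ (V n `\` E n).
have mVE n : measurable (V n `\` E n).
  by apply: measurableD => //; apply: open_measurable; have [] := VP n.
have mp n : measurable_fun [set: R] (p n).
  have mg : measurable_fun (V n `\` E n) (fun y : R => (`|W y| + `|c n|)%:E).
    apply/measurable_EFinP; apply: measurable_funD => //.
    by apply: measurableT_comp => //; exact: measurable_funTS.
  by apply/(measurable_restrictT _ _).1 => //; exact: mVE.
have p0 n y : (0 <= p n y)%E.
  by rewrite /p patchE; case: ifP => // _; rewrite lee_fin addr_ge0.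
exists (fun y => \sum_(n <oo) p n y)%E; split.
- by apply: ge0_emeasurable_sum.
- by move=> y; apply: nneseries_ge0.
- rewrite integral_nneseries //; apply: le_trans (epsilon_trick0 xpredT (ltW e0)).
  apply: lee_nneseries => [n *|n *]; first by apply: integral_ge0.
  by rewrite /p -integral_mkcond; have [] := VP n.
- move=> x Ax; pose n := pickle (Num.floor (W x / e)).
  have cn : c n = e * (Num.floor (W x / e))%:~R by rewrite /c /n pickleK.
  have cW : c n <= W x by rewrite cn mulrC -ler_pdivlMr // floor_le.
  have Wc : W x < c n + e.
    by have := floorD1_gt (W x / e); rewrite intrD ltr_pdivrMr // mulrDl mul1r cn (mulrC e).
  have [oV EV _] := VP n.
  have : V n x by apply: EV; split => //=; rewrite in_itv /= cW Wc.
  move=> /oV[d /= d0 Hd]; exists d => // y yx.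
  have Vy : V n y by apply: Hd; rewrite /ball_ /= distrC.
  have Wxc : W x - e <= c n by rewrite lerBlDr ltW.
  (* On the level set [W y] is already above [c n]; on the rest of the neighbourhood the error
     [|W y| + |c n|] makes up for the deficit. *)
  have [Ey|nEy] := pselect (E n y).
    have [_ /=] := Ey; rewrite in_itv /= => /andP[cy _].
    apply: (@le_trans _ _ (W y)%:E); first by rewrite lee_fin (le_trans Wxc).
    by rewrite leeDl // nneseries_ge0.
  apply: (@le_trans _ _ ((W y)%:E + p n y)%E).
    rewrite /p patchE mem_set //.
    rewrite -EFinD lee_fin (le_trans Wxc) // addrA (le_trans (ler_norm _)) // lerDr.
    by rewrite addrC -lerBlDr sub0r ler_normr lexx orbT.
  rewrite leeD2l //; apply: le_trans (nneseries_lim_ge n.+1 _) => //.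
  by rewrite big_nat_recr //= leeDr // sume_ge0.
Qed.

(** One inequality suffices, the other being its case for [- f]. Near each [x] the function
    [W + psi] stays above [w x - e'], so [f] minus the primitive [q] of [W + psi] minus a small
    linear term is locally nonincreasing. *)
Lemma derivable_FTC (f w : R -> R) (a b : R) : a <= b ->
  (forall x, a <= x <= b -> is_derive x 1 f (w x)) ->
  mu.-integrable `[a, b] (EFin \o w) ->
  f b - f a = \int[mu]_(x in `[a, b]) w x.
Proof.
suff le_FTC (f' w' : R -> R) : a <= b ->
    (forall x, a <= x <= b -> is_derive x 1 f' (w' x)) ->
    mu.-integrable `[a, b] (EFin \o w') ->
    f' b - f' a <= \int[mu]_(x in `[a, b]) w' x.
  move=> ab df wi; apply/le_anti; rewrite le_FTC //=.
  have : - f b - - f a <= \int[mu]_(x in `[a, b]) - w x.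
    apply: (le_FTC (fun x => - f x) (fun x => - w x)) => //.
    - by move=> x /df ?; apply: is_deriveN.
    - by have := integrableN wi; apply: eq_integrable.
  rewrite -opprD lerNl; apply: le_trans.
  rewrite (_ : (fun _ => - _) = (fun x => -1 * w x)); last first.
    by apply/funext => x; rewrite mulN1r.
  by rewrite RintegralZl // mulN1r opprK.
move=> ab df wi; pose W := w' \_ `[a, b].
have Wi : mu.-integrable [set: R] (EFin \o W).
  rewrite /W -restrict_EFin; apply/integrable_restrict => //.
  by rewrite setTI.
apply/ler_addgt0Pr => e e0.
(* Chosen so that the total loss [e' + 2 * e' * (b - a)] equals [e]. *)
pose e' := e / (1 + 2 * (b - a)).
have e'd : 0 < 1 + 2 * (b - a) by rewrite ltr_pwDl // mulr_ge0 // subr_ge0.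
have e'0 : 0 < e' by rewrite divr_gt0.
have [|psi [mpsi psi0 psie Hpsi]] := vitali_caratheodory W `[a, b] e' (measurable_itv _) _ e'0 Wi.
  by rewrite lebesgue_measure_itv /=; case: ifP => // _; rewrite -EFinD ltry.
pose Q x : \bar R := ((W x)%:E + psi x)%E.
have psi_int : mu.-integrable [set: R] psi.
  apply/integrableP; split => //; apply: le_lt_trans (ltry e'); apply: le_trans psie.
  by apply: ge0_le_integral => // [|x _]; [exact: measurableT_comp|rewrite gee0_abs].
have Qi : mu.-integrable [set: R] Q by apply: integrableD.
have mQ : measurable_fun [set: R] Q by exact: measurable_int Qi.
have Qfin (A : set R) : measurable A -> (\int[mu]_(x in A) Q x)%E \is a fin_num.
  by move=> mA; apply: integrable_fin_num => //; apply: integrableS Qi.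
pose q x := fine (\int[mu]_(y in `]a, x]) Q y)%E.
have qB u v : a <= u -> u <= v ->
    q v - q u = fine (\int[mu]_(y in `]u, v]) Q y)%E.
  move=> au uv; rewrite /q.
  have -> : `]a, v]%classic = (`]a, u] `|` `]u, v])%classic :> set R.
    by rewrite -itv_bndbnd_setU // bnd_simp.
  rewrite integral_setU //; last 2 first.
  - exact: measurable_funTS.
  - apply/disj_setPS => y [/=]; rewrite !in_itv /= => /andP[_ yu] /andP[].
    by rewrite ltNge yu.
  by rewrite fineD ?Qfin // addrC addKr.
(* The slope [2 * e'] absorbs one [e'] from the difference quotient of [f'] and one from the lower
   bound on [W + psi]. *)
pose D x := f' x - q x - 2 * e' * x.
have DD : D b <= D a.
  apply: locally_nonincreasing => // x xab.
  have [d1 d10 H1] := derivable_slope _ _ _ _ (df x xab) e'0.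
  have [|d2 d20 H2] := Hpsi x; first by rewrite /= in_itv.
  exists (Num.min d1 d2); first by rewrite lt_min d10.
  move=> u v au vb /andP[ux xv] du dv.
  have ball_ y : u <= y <= v -> `|y - x| < Num.min d1 d2.
    move=> /andP[uy yv]; rewrite ltr_norml; apply/andP; split.
      by rewrite ltrBrDl (lt_le_trans du).
    by rewrite ltrBlDl (le_lt_trans yv).
  have uv := le_trans ux xv.
  have Wx : W x = w' x by rewrite /W patchE mem_set //= in_itv.
  have Hf : f' v - f' u <= (w' x + e') * (v - u).
    have bv : `|v - x| < d1 by have := ball_ v; rewrite uv lexx lt_min => /(_ isT) /andP[].
    have bu : `|u - x| < d1 by have := ball_ u; rewrite uv lexx lt_min => /(_ isT) /andP[].
    have := H1 v bv; have := H1 u bu.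
    rewrite ler_norml => /andP[+ _]; rewrite ler_norml => + /andP[_ +].
    rewrite (ger0_norm (_ : 0 <= v - x)) ?subr_ge0 // distrC ger0_norm ?subr_ge0 //.
    by lra.
  have Hq : (w' x - e') * (v - u) <= q v - q u.
    rewrite qB // -lee_fin fineK ?Qfin // -Wx.
    have -> : ((W x - e') * (v - u))%:E = (\int[mu]_(y in `]u, v]) (W x - e')%:E)%E.
      rewrite integral_cst //= lebesgue_measure_itv /= lte_fin.
      case: ltP => [//|vu]; have -> : v = u by apply/le_anti; rewrite vu uv.
      by rewrite subrr mulr0 mule0.
    apply: le_integral => //.
    - exact: integrable_cst_itv.
    - by apply: integrableS Qi.
    - move=> y; rewrite inE /= in_itv /= => /andP[uy yv]; apply: H2.
      by have := ball_ y; rewrite (ltW uy) yv lt_min => /(_ isT) /andP[].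
  rewrite /D; have : 0 <= e' by exact: ltW.
  move: Hf Hq; move: (w' x) => ww; rewrite !mulrDl !mulrBr !mulNr; lra.
have qa : q a = 0 by rewrite /q set_itvoc0 integral_set0.
have qb : q b <= \int[mu]_(x in `[a, b]) w' x + e'.
  rewrite -lee_fin /q fineK ?Qfin // /Q integralD //; last 2 first.
  - by apply: integrableS Wi.
  - by apply: integrableS psi_int.
  rewrite EFinD; apply: leeD; last first.
    by apply: le_trans psie; apply: ge0_subset_integral.
  rewrite integral_itv_obnd_cbnd //; last by apply: measurable_funTS; exact: measurable_int Wi.
  rewrite le_eqVlt /Rintegral fineK ?integrable_fin_num //; apply/orP; left; apply/eqP.
  by apply: eq_integral => x xab; rewrite /W /= patchE xab.
have -> : e = e' + 2 * e' * (b - a).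
  by rewrite /e'; field; rewrite gt_eqF.
move: DD; rewrite /D qa subr0; move: qb.
rewrite mulrBr; lra.
Qed.

End derivative_FTC.

(** * Entire power series and power series in [t^nu] *)

Section entire_series.
Context {R : realType}.
Implicit Types (d : nat -> R) (b t x nu l : R).

Definition entire d := forall x, cvgn (series (fun n => `|d n * x ^+ n|)).

Definition psum d x : R := limn (series (fun n => d n * x ^+ n)).

Lemma cvg_norm_series (f : nat -> R) : cvgn (series (fun n => `|f n|)) -> cvgn (series f).
Proof. exact: normed_cvg. Qed.

Lemma entire_cvg d x : entire d -> cvgn (series (fun n => d n * x ^+ n)).
Proof. by move=> /(_ x) /cvg_norm_series. Qed.

Lemma series_cvgD (f g : nat -> R) l l' : series f @ \oo --> l -> series g @ \oo --> l' ->
  series (fun n => f n + g n) @ \oo --> l + l'.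
Proof.
move=> fl gl; rewrite (_ : series _ = series f + series g); first exact: cvgD.
by rewrite -seriesD.
Qed.

Lemma series_cvgZ (f : nat -> R) c l : series f @ \oo --> l ->
  series (fun n => c * f n) @ \oo --> c * l.
Proof.
move=> fl; rewrite (_ : series _ = c *: series f); first exact: cvgZr.
by rewrite -seriesZ.
Qed.

Lemma series_cvg_shift (f : nat -> R) k l : (forall i, (i < k)%N -> f i = 0) ->
  series (fun n => f (n + k)%N) @ \oo --> l <-> series f @ \oo --> l.
Proof.
move=> f0; rewrite -(cvg_shiftn k (series f)).
suff -> : [sequence series f (n + k)%N]_n = series (fun n => f (n + k)%N) by [].
apply/funext => n; rewrite /series /=.
rewrite (@big_cat_nat _ _ _ k) ?leq_addl //= big_nat_cond big1 ?add0r; last first.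
  by move=> i /andP[/andP[_ ik] _]; exact: f0.
by rewrite -{1}(add0n k) big_addn addnK.
Qed.

Lemma is_cvg_seriesS (g : nat -> R) : (forall n, 0 <= g n) -> cvgn (series g) ->
  cvgn (series (fun n => g n.+1)).
Proof.
move=> g0 cg; pose g' n := if n is 0%N then 0 else g n.
have cg' : cvgn (series g').
  by apply: series_le_cvg cg => // n; rewrite /g'; case: n.
apply/cvg_ex; exists (limn (series g')).
have g'0 i : (i < 1)%N -> g' i = 0 by case: i.
have := (series_cvg_shift g' 1 (limn (series g')) g'0).2 cg'.
rewrite (_ : (fun n => g' _) = (fun n => g n.+1)); last by apply/funext => n; rewrite addn1.
by [].
Qed.

(** Convergence at every point lets the factor [K ^+ n] be absorbed into the argument. *)
Lemma entire_le d d' C K : 0 <= K -> (forall n, `|d' n| <= C * K ^+ n * `|d n|) ->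
  entire d -> entire d'.
Proof.
move=> K0 dd ed x.
have le n : `|d' n * x ^+ n| <= C * `|d n * (K * x) ^+ n|.
  rewrite !normrM exprMn normrM (ger0_norm (exprn_ge0 _ K0)).
  apply: le_trans (ler_wpM2r _ (dd n)) _ => //.
  by rewrite le_eqVlt; apply/orP; left; apply/eqP; ring.
apply: (@series_le_cvg _ _ (fun n => C * `|d n * (K * x) ^+ n|)) => //.
- by move=> n; exact: le_trans (le n).
- by apply/cvg_ex; eexists; apply: series_cvgZ; exact: ed.
Qed.

Lemma entire_affine d b c : entire d -> entire (fun n => (b + n%:R * c) * d n).
Proof.
apply: (@entire_le _ _ (`|b| + `|c|) 2) => // n.
rewrite normrM ler_wpM2r // (le_trans (ler_normD _ _)) // mulrDl lerD //.
  by rewrite ler_peMr // exprn_ege1 // ler1n.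
rewrite normrM normr_nat mulrC ler_wpM2l // -natrX ler_nat ltnW //.
exact: ltn_expl.
Qed.

Lemma entireS d : entire d -> entire (fun n => d n.+1).
Proof.
move=> ed x; pose X := `|x| + 1.
have X1 : 1 <= X by rewrite lerDr.
apply: series_le_cvg (is_cvg_seriesS (fun n => `|d n * X ^+ n|) _ (ed X)) => // n.
rewrite !normrM ler_wpM2l // normrX [`|X ^+ _|]ger0_norm ?exprn_ge0 ?(le_trans ler01 X1) //.
rewrite exprS (@le_trans _ _ (X ^+ n)) //.
  by rewrite lerXn2r ?nnegrE ?(le_trans ler01 X1) // lerDl.
by rewrite ler_peMl // exprn_ge0 // (le_trans ler01).
Qed.

Lemma entire_diffs d : entire d -> entire (pseries_diffs d).
Proof.
move=> /(entire_affine _ 0 1) /entireS.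
by under eq_fun do rewrite add0r mulr1.
Qed.

Lemma psum_is_derive d x : entire d ->
  is_derive x 1 (psum d) (psum (pseries_diffs d) x).
Proof.
move=> ed; have ed1 := entire_diffs _ ed; have ed2 := entire_diffs _ ed1.
apply: (@pseries_snd_diffs _ d (`|x| + 1)); try exact: entire_cvg.
by rewrite [ltRHS]ger0_norm ?addr_ge0 // ltrDl.
Qed.

(** Multiplying the coefficients by [n] is the Euler operator [x d/dx]. *)
Lemma psum_affine d b c x : entire d ->
  psum (fun n => (b + n%:R * c) * d n) x =
  b * psum d x + c * (x * psum (pseries_diffs d) x).
Proof.
move=> ed; apply/cvg_lim => //.
under eq_fun do rewrite mulrDl mulrDl.
rewrite (_ : (fun n => _) = (fun n => b * (d n * x ^+ n) + c * (n%:R * d n * x ^+ n))); last first.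
  by apply/funext => n; ring.
apply: series_cvgD; first by apply: series_cvgZ; apply: entire_cvg.
apply: series_cvgZ.
apply/(series_cvg_shift (fun n => n%:R * d n * x ^+ n) 1); first by case=> // _; rewrite !mul0r.
rewrite (_ : (fun n => _) = (fun n => x * (pseries_diffs d n * x ^+ n))); last first.
  by apply/funext => n; rewrite /pseries_diffs addn1 exprS; ring.
by apply: series_cvgZ; apply: entire_cvg; exact: entire_diffs.
Qed.

Lemma psum0 d : psum d 0 = d 0%N.
Proof.
apply/cvg_lim => //; apply: cvg_near_cst.
exists 1%N => //= n /= n1; rewrite /series /= -(prednK n1) big_nat_recl //= expr0 mulr1.
by rewrite big1 ?addr0 // => i _; rewrite expr0n mulr0.
Qed.

(** This family is stable under differentiation, which multiplies each coefficient by its exponent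
    [b + n nu] and lowers [b] by one. *)
Definition rpsum nu b d t := t `^ b * psum d (t `^ nu).

Lemma rpsum_is_derive nu b d t : entire d -> 0 < t ->
  is_derive t 1 (rpsum nu b d) (rpsum nu (b - 1) (fun n => (b + n%:R * nu) * d n) t).
Proof.
move=> ed t0.
have p1 := is_derive1_powR b t0; have p2 := is_derive1_powR nu t0.
have p3 := is_derive1_comp (g := fun s : R => s `^ nu) (psum_is_derive _ (t `^ nu) ed) p2.
have := is_deriveM p1 p3.
rewrite /= => H; apply: is_derive_eq H _.
rewrite /rpsum psum_affine // /GRing.scale /=.
have E c : t `^ c = t `^ (c - 1) * t.
  by rewrite -{3}(powRr1 (ltW t0)) -powRDgt0 // subrK.
rewrite (E b) (E nu); ring.
Qed.

Definition falling_factor nu m n : R := \prod_(i < m) (n%:R * nu - i%:R).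

Lemma entire_falling nu m d : entire d -> entire (fun n => falling_factor nu m n * d n).
Proof.
move=> ed; elim: m => [|m IH].
  by under eq_fun do rewrite /falling_factor big_ord0 mul1r.
rewrite (_ : (fun n => _) = (fun n => (- m%:R + n%:R * nu) * (falling_factor nu m n * d n))).
  exact: entire_affine.
by apply/funext => n; rewrite /falling_factor big_ord_recr /=; ring.
Qed.

(** Formula and derivability are proved together: the formula of order [k] on the whole open
    half-line is what allows differentiating once more. *)
Lemma rpsum_derive1n nu d m : entire d -> forall t, 0 < t ->
  derive1n m (rpsum nu 0 d) t = rpsum nu (- m%:R) (fun n => falling_factor nu m n * d n) t /\
  derivable (derive1n m (rpsum nu 0 d)) t 1.
Proof.
move=> ed.
have H k : (forall t, 0 < t -> derive1n k (rpsum nu 0 d) t =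
      rpsum nu (- k%:R) (fun n => falling_factor nu k n * d n) t) ->
    forall t, 0 < t -> is_derive t 1 (derive1n k (rpsum nu 0 d))
      (rpsum nu (- k.+1%:R) (fun n => falling_factor nu k.+1 n * d n) t).
  move=> Hk t t0.
  have := rpsum_is_derive nu (- k%:R) _ t (entire_falling nu k _ ed) t0.
  rewrite -opprD natr1 => D.
  have {}D : is_derive t 1 (rpsum nu (- k%:R) (fun n => falling_factor nu k n * d n))
      (rpsum nu (- k.+1%:R) (fun n => falling_factor nu k.+1 n * d n) t).
    apply: is_derive_eq D _; rewrite /rpsum; congr (_ * psum _ _).
    by apply/funext => n; rewrite /falling_factor big_ord_recr /=; ring.
  apply: near_eq_is_derive D.
  near=> s; apply/esym/Hk; near: s; exact: lt_nbhsr.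
elim: m => [|m IH] t t0.
  split.
    rewrite derive1n0 oppr0; congr (rpsum _ _ _ _).
    by apply/funext => n; rewrite /falling_factor big_ord0 mul1r.
  have [] // := H 0%N _ t t0.
  move=> s s0; rewrite derive1n0 oppr0; congr (rpsum _ _ _ _).
  by apply/funext => n; rewrite /falling_factor big_ord0 mul1r.
have Hm := H m (fun s s0 => (IH s s0).1).
have Em s : 0 < s -> derive1n m.+1 (rpsum nu 0 d) s =
      rpsum nu (- m.+1%:R) (fun n => falling_factor nu m.+1 n * d n) s.
  by move=> s0; rewrite derive1nS derive1E; have [_ ->] := Hm s s0.
split; first exact: Em.
by have [] := H m.+1 Em t t0.
Unshelve. all: by end_near. Qed.

(** Each factor [n nu - i] is cancelled by one use of the recurrence of [Gamma]; the hypothesis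
    keeps all arguments positive. *)
Lemma falling_Gamma nu m n : m%:R - 1 < n%:R * nu ->
  falling_factor nu m n / Gamma (n%:R * nu + 1) = (Gamma (n%:R * nu - m%:R + 1))^-1.
Proof.
elim: m => [|m IH] nm; first by rewrite /falling_factor big_ord0 div1r subr0.
have nm' : m%:R < n%:R * nu by rewrite -[X in X < _](addrK 1) natr1.
rewrite /falling_factor big_ord_recr /= mulrAC IH; last first.
  by rewrite (lt_trans _ nm') // gtrBl.
have p : 0 < n%:R * nu - m%:R by rewrite subr_gt0.
rewrite Gamma_rec // -natr1 opprD addrA subrK invfM mulrC mulrA mulfV ?mul1r // gt_eqF //.
Qed.

(** With [B = 2 (|x| + 1)] and [A = B^(1/nu)], the lower bound on [Gamma] reads
    [Gamma (n nu + 1) >= B^n exp(-A)], so the terms are at most [exp(A) / 2^n]. *)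
Lemma entire_invGamma nu : 0 < nu -> entire (fun n => (Gamma (n%:R * nu + 1))^-1).
Proof.
move=> nu0 x.
pose B := 2 * (`|x| + 1); have B0 : 0 < B by rewrite mulr_gt0 // ltr_wpDl.
pose A := B `^ nu^-1; have A0 : 0 < A by rewrite powR_gt0.
have AB n : A `^ (n%:R * nu) = B ^+ n.
  by rewrite /A -powRrM mulrCA mulVf ?gt_eqF // mulr1 powR_mulrn // ltW.
apply: (@series_le_cvg _ _ (geometric (expR A) 2^-1)) => //.
- by move=> n; rewrite /= mulr_ge0 ?expR_ge0 // exprn_ge0 // invr_ge0.
- move=> n; have G1 := Gamma_ge _ _ (mulr_ge0 (ler0n R n) (ltW nu0)) A0.
  have G0 : 0 < Gamma (n%:R * nu + 1).
    by apply: Gamma_gt0; rewrite ltr_wpDl // mulr_ge0 // ltW.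
  rewrite /= normrM normrX gtr0_norm ?invr_gt0 // mulrC ler_pdivrMr //.
  apply: (@le_trans _ _ (expR A * 2^-1 ^+ n * (A `^ (n%:R * nu) * expR (- A)))); last first.
    by rewrite ler_wpM2l // mulr_ge0 ?expR_ge0 // exprn_ge0 // invr_ge0.
  rewrite mulrACA -mulrA [X in _ <= X](_ : _ = (2^-1 ^+ n * A `^ (n%:R * nu)) * (expR A * expR (- A))); last by ring.
  rewrite -expRD subrr expR0 mulr1 AB -exprMn lerXn2r ?nnegrE //.
    by rewrite mulr_ge0 // ?invr_ge0 // ltW.
  by rewrite /B mulKf ?pnatr_eq0 // lerDl.
- by apply: is_cvg_geometric_series; rewrite ger0_norm ?invr_ge0 // invf_lt1 // ltr1n.
Qed.

Lemma entire_mittag_leffler nu (c : nat -> R) C K : 0 < nu -> 0 <= K -> (forall n, `|c n| <= C * K ^+ n) ->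
  entire (fun n => c n / Gamma (n%:R * nu + 1)).
Proof.
move=> nu0 K0 cK; apply: (@entire_le _ _ C K) (entire_invGamma nu nu0) => // n.
by rewrite normrM ler_wpM2r.
Qed.

End entire_series.

(** * Termwise integration and Caputo derivatives of power series *)

Section series_of_integrals.
Context {R : realType}.
Local Notation mu := (@lebesgue_measure R).

(** Dominated convergence of the partial sums, with the sum of all [|g n|] as dominating function;
    its integral is the sum of the [I n]. *)
Lemma integral_series (g : nat -> R -> R) (I : nat -> R) (f : R -> R) :
  (forall n, measurable_fun [set: R] (g n)) ->
  (forall n, (\int[mu]_x `|g n x|%:E = (I n)%:E)%E) -> cvgn (series I) ->
  (forall x, series (g ^~ x) @ \oo --> f x) ->
  mu.-integrable [set: R] (EFin \o f) /\
  series (fun n => \int[mu]_x g n x) @ \oo --> \int[mu]_x f x.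
Proof.
move=> mg gI cI gf.
have gfin : (\sum_(n <oo) \int[mu]_x `|g n x|%:E < +oo)%E.
  under eq_eseriesr => n _ do rewrite gI.
  rewrite (_ : (fun N => _) = EFin \o series I); last first.
    by apply/funext => N; rewrite /= /series /= sumEFin.
  by rewrite EFin_lim // ltry.
pose G x : \bar R := (\sum_(n <oo) `|g n x|%:E)%E.
have mng n : measurable_fun [set: R] (fun x => `|g n x|%:E).
  by apply/measurable_EFinP; apply: measurableT_comp.
have G0 x : (0 <= G x)%E by apply: nneseries_ge0 => n _ _; rewrite lee_fin.
have mG : measurable_fun [set: R] G.
  by apply: ge0_emeasurable_sum => // n x _ _; rewrite lee_fin.
have iG : mu.-integrable [set: R] G.
  apply/integrableP; split => //.
  under eq_integral => x _ do rewrite gee0_abs //.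
  by rewrite /G integral_nneseries // => n x _; rewrite lee_fin.
have gi n : mu.-integrable [set: R] (EFin \o g n).
  apply: le_integrable iG => //; first by apply/measurable_EFinP; exact: mg.
  move=> x _ /=; rewrite gee0_abs //.
  apply: le_trans (nneseries_lim_ge n.+1 _); last by move=> k _ _; rewrite lee_fin.
  by rewrite big_nat_recr //= leeDr // sume_ge0.
have [|||||fi _ H] := @dominated_convergence _ _ _ mu _ measurableT
    (fun N => EFin \o (fun x => series (g ^~ x) N)) (EFin \o f) G.
- by move=> n; apply/measurable_EFinP; apply: measurable_sum.
- apply: (emeasurable_fun_cvg (fun N => EFin \o (fun x => series (g ^~ x) N))).
  + by move=> n; apply/measurable_EFinP; apply: measurable_sum.
  + by move=> x _; apply: cvg_EFin; [exact: nearW|exact: gf].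
- by apply: aeW => x _; apply: cvg_EFin; [exact: nearW|exact: gf].
- exact: iG.
- apply: aeW => x n _ /=; apply: le_trans (nneseries_lim_ge n _); last first.
    by move=> k _ _; rewrite lee_fin.
  by rewrite /series /= sumEFin lee_fin; exact: ler_norm_sum.
split => //.
have fE : (\int[mu]_x (EFin \o f) x = (\int[mu]_x f x)%:E)%E.
  by rewrite /Rintegral fineK //; exact: integrable_fin_num.
move: H; rewrite [X in _ --> X](_ : _ = (\int[mu]_x f x)%:E); last exact: fE.
move=> /fine_cvg.
rewrite (_ : fine \o _ = series (fun n => \int[mu]_x g n x)) //.
apply/funext => N /=; rewrite /series /=.
under eq_integral do rewrite -sumEFin.
rewrite (integral_sum measurableT gi).
rewrite -sum_fine // => i _; exact: integrable_fin_num.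
Qed.

Lemma series_cvg0 : series (fun=> 0 : R) @ \oo --> (0 : R).
Proof.
rewrite (_ : series _ = fun=> 0); first exact: cvg_cst.
by apply/funext => n; rewrite /series /= big1.
Qed.

(** On the normalized powers [kpow b / Gamma b] the operator [fint a] just adds [a] to [b].
    Integration is termwise because the absolute integrals are [Gamma a] times the terms of the
    series assumed convergent. *)
Lemma fint_power_series a (e b : nat -> R) t (f : R -> R) : 0 < a -> 0 < t ->
  (forall n, 0 < b n) ->
  cvgn (series (fun n => `|e n * (kpow (b n + a) t / Gamma (b n + a))|)) ->
  (forall s, s <= 0 -> f s = 0) ->
  (forall s, 0 < s < t -> series (fun n => e n * (kpow (b n) s / Gamma (b n))) @ \oo --> f s) ->
  kintegrable a f t /\
  series (fun n => e n * (kpow (b n + a) t / Gamma (b n + a))) @ \oo --> fint a f t.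
Proof.
move=> a0 t0 b0 ecvg f0 ef.
pose h n s := e n * (kpow (b n) s / Gamma (b n)).
have mh n : measurable_fun [set: R] (h n).
  by apply: measurable_funM => //; apply: measurable_funM => //; exact: measurable_kpow.
have Gb n : 0 < Gamma (b n) by exact: Gamma_gt0.
have Ga : 0 < Gamma a by exact: Gamma_gt0.
have Gab n : 0 < Gamma (b n + a) by apply: Gamma_gt0; exact: addr_gt0.
have mk n : measurable_fun [set: R] (fun x => kpow a (t - x) * kpow (b n) x).
  by apply: measurable_funM; [exact: measurable_kpow_sub|exact: measurable_kpow].
have kk n : (\int[mu]_x (kpow a (t - x) * kpow (b n) x)%:E)%E =
    (Gamma a * Gamma (b n) / Gamma (b n + a) * kpow (b n + a) t)%:E.
  under eq_integral => x _ do rewrite -[X in kpow (b n) X]subr0.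
  by rewrite kpow_convolution betaEFin // subr0 -EFinM (addrC a).
have ki n : mu.-integrable [set: R] (fun x => (kpow a (t - x) * kpow (b n) x)%:E).
  apply/integrableP; split; first by apply/measurable_EFinP; exact: mk.
  under eq_integral => x _ do rewrite /= ger0_norm ?mulr_ge0 ?kpow_ge0 //.
  by rewrite kk ltry.
have kintE n x : kint a (h n) t x = (e n / Gamma (b n)) * (kpow a (t - x) * kpow (b n) x).
  by rewrite /kint /h; ring.
have [|n||x|fi Hf] := integral_series (fun n => kint a (h n) t)
  (fun n => Gamma a * `|e n * (kpow (b n + a) t / Gamma (b n + a))|) (kint a f t).
- by move=> n; exact: measurable_kint.
- under eq_integral => x _.
    rewrite kintE normrM [`|kpow _ _ * _|]ger0_norm ?mulr_ge0 ?kpow_ge0 // EFinM.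
    over.
  rewrite ge0_integralZl //; last 2 first.
  + by apply/measurable_EFinP; exact: mk.
  + by move=> x _; rewrite lee_fin mulr_ge0 ?kpow_ge0.
  rewrite kk -EFinM; congr EFin.
  rewrite !normrM !normfV (gtr0_norm (Gab n)) (gtr0_norm (Gb n)) (ger0_norm (kpow_ge0 _ _)).
  move: (Gamma a) (Gamma (b n)) (Gamma _) (kpow _ _) (gt_eqF (Gb n)) (gt_eqF (Gab n)).
  by move=> x y z k y0 z0; field; rewrite y0 z0.
- by apply/cvg_ex; eexists; apply: series_cvgZ; exact: ecvg.
- have [tx|xt] := leP t x.
    rewrite kint_ge // (_ : (fun n => _) = (fun n => 0)); last first.
      by apply/funext => n; rewrite kint_ge.
    exact: series_cvg0.
  have [x0|x0] := leP x 0.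
    rewrite /kint f0 // mulr0 (_ : (fun n => _) = (fun n => 0)); last first.
      by apply/funext => n; rewrite /h (kpow_le0 (b n)) // mul0r !mulr0.
    exact: series_cvg0.
  by rewrite /kint; apply: series_cvgZ; apply: ef; rewrite x0.
split => //.
rewrite /fint; have := series_cvgZ _ (Gamma a)^-1 _ Hf.
rewrite (_ : (fun n => _) = (fun n => e n * (kpow (b n + a) t / Gamma (b n + a)))) //.
apply/funext => n.
rewrite (_ : kint a (h n) t = (fun x => (e n / Gamma (b n)) * (kpow a (t - x) * kpow (b n) x))); last first.
  by apply/funext => x; exact: kintE.
rewrite RintegralZl //; last exact: ki.
have -> : \int[mu]_x (kpow a (t - x) * kpow (b n) x) = _ := congr1 fine (kk n).
rewrite /=.
move: (Gamma a) (Gamma (b n)) (Gamma _) (kpow _ _) (gt_eqF Ga) (gt_eqF (Gb n)) (gt_eqF (Gab n)).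
by move=> x y z k x0 y0 z0; field; rewrite x0 y0 z0.
Qed.

(** A truncation in the argument, not in the values. *)
Definition pos_part (w : R -> R) (s : R) : R := if 0 < s then w s else 0.

(** The Caputo kernel is the power kernel of order [m - alpha], so a Caputo derivative is
    [fint (m - alpha)] applied to the [m]-th derivative. *)
Lemma caputo_kernel (alpha m t : R) (w : R -> R) :
  kint (m - alpha) (pos_part w) t =
  (fun s => ((t - s) `^ (1 + alpha - m))^-1 * w s) \_ `]0, t[.
Proof.
apply/funext => s; rewrite patchE mem_setE in_itv /= /kint /pos_part.
case: ltP => s0; last by rewrite mulr0.
have [st|ts] := ltP s t; last by rewrite kpow_le0 ?mul0r // subr_le0.
rewrite kpow_gt0E ?subr_gt0 // -powRN; congr (_ `^ _ * _); ring.
Qed.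

Lemma caputo_integrable (alpha m t : R) (w : R -> R) :
  mu.-integrable `]0, t[ (fun s => (((t - s) `^ (1 + alpha - m))^-1 * w s)%:E) <->
  kintegrable (m - alpha) (pos_part w) t.
Proof.
rewrite /kintegrable caputo_kernel -restrict_EFin.
exact: integrable_mkcond.
Qed.

Lemma caputo_integral (alpha m t : R) (w : R -> R) :
  (Gamma (m - alpha))^-1 * \int[mu]_(s in `]0, t[) (((t - s) `^ (1 + alpha - m))^-1 * w s) =
  fint (m - alpha) (pos_part w) t.
Proof. by rewrite /fint caputo_kernel -Rintegral_mkcond. Qed.

Lemma powR_natM (nu s : R) n : s `^ (n%:R * nu) = (s `^ nu) ^+ n.
Proof. by rewrite mulrC powRrM powR_mulrn // powR_ge0. Qed.

Lemma kpow_natM (nu s : R) n : 0 < s -> kpow (n%:R * nu + 1) s = (s `^ nu) ^+ n.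
Proof. by move=> s0; rewrite kpow_gt0E // addrK powR_natM. Qed.

(** The [m] ordinary derivatives take [t^(n nu) / Gamma (n nu + 1)] to
    [t^(n nu - m) / Gamma (n nu - m + 1)], and the integral of order [m - p nu] raises the exponent
    to [(n - p) nu]: the coefficient sequence is shifted by [p]. From [n = p] on, the intermediate
    exponents exceed -1. *)
Lemma is_caputo_rpsum (nu : R) (c : nat -> R) (C K : R) (m p : nat) (t : R) :
  0 < nu -> 0 <= K -> (forall n, `|c n| <= C * K ^+ n) ->
  (0 < p)%N -> (forall n, (0 < n < p)%N -> c n = 0) ->
  m%:R - 1 < p%:R * nu <= m%:R -> 0 < t ->
  is_caputo (p%:R * nu) (rpsum nu 0 (fun n => c n / Gamma (n%:R * nu + 1))) t
    (rpsum nu 0 (fun n => c (n + p)%N / Gamma (n%:R * nu + 1)) t).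
Proof.
move=> nu0 K0 cK p0 cp /andP[mp pm] t0.
set d := fun n => c n / Gamma (n%:R * nu + 1).
set F := rpsum nu 0 d.
have ed : entire d by apply: entire_mittag_leffler cK.
have m0 : (0 < m)%N.
  by rewrite -(ltr_nat R) (lt_le_trans _ pm) // mulr_gt0 // ltr0n.
have mnp n : m%:R - 1 < (n + p)%:R * nu.
  by rewrite (lt_le_trans mp) // ler_wpM2r ?(ltW nu0) // ler_nat leq_addl.
have dF (s : R) : 0 < s ->
    series (fun n => c (n + p)%N * (kpow ((n + p)%:R * nu - m%:R + 1) s /
     Gamma ((n + p)%:R * nu - m%:R + 1))) @ \oo --> derive1n m F s.
  move=> s0; rewrite (rpsum_derive1n _ _ _ ed s s0).1 /rpsum.
  have := entire_cvg _ (s `^ nu) (entire_falling nu m _ ed).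
  move=> /(series_cvgZ _ (s `^ (- m%:R))).
  set g := fun n => s `^ _ * _ => H.
  (* The constant term dies because [falling_factor] starts with the factor 0 when [m > 0]; the
     other terms below [p] vanish by hypothesis. Their exponents could be too negative for
     integrability at 0. *)
  have g0 i : (i < p)%N -> g i = 0.
    rewrite /g; case: i => [|i] ip.
      rewrite /falling_factor; case: (m) m0 => // k _.
      by rewrite big_ord_recl !mul0r subr0 !mul0r mulr0.
    by rewrite /d cp ?ip // mul0r mulr0 mul0r mulr0.
  rewrite (_ : (fun n => _) = (fun n => g (n + p)%N)); first exact/(series_cvg_shift g p _ g0).
  apply/funext => n; rewrite /g /d -falling_Gamma // kpow_gt0E // addrK powRDgt0 //.
  by rewrite powR_natM; ring.
have ed' : entire (fun n => c (n + p)%N / Gamma (n%:R * nu + 1)).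
  apply: (@entire_mittag_leffler _ _ _ (C * K ^+ p) K) => // n.
  by apply: le_trans (cK _) _; rewrite exprD mulrAC mulrA.
have valE (v : R) :
    series (fun n => c (n + p)%N * (kpow (n%:R * nu + 1) t / Gamma (n%:R * nu + 1))) @ \oo --> v ->
    rpsum nu 0 (fun n => c (n + p)%N / Gamma (n%:R * nu + 1)) t = v.
  move=> Hv; rewrite /rpsum powRr0 mul1r; apply/cvg_lim => //.
  rewrite (_ : (fun n => _) = (fun n => c (n + p)%N * (kpow (n%:R * nu + 1) t / Gamma (n%:R * nu + 1)))) //.
  by apply/funext => n; rewrite kpow_natM //; ring.
have [pme|pmne] := eqVneq (p%:R * nu) m%:R.
  right; exists m; split => //.
    near=> s; move=> i im.
    apply: (rpsum_derive1n nu _ i ed s _).2.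
    by near: s; exact: lt_nbhsr.
  apply: valE; rewrite (_ : (fun n => _) = (fun n => c (n + p)%N * (kpow ((n + p)%:R * nu - m%:R + 1) t /
     Gamma ((n + p)%:R * nu - m%:R + 1)))); first exact: dF.
  by apply/funext => n; rewrite natrD mulrDl pme addrK.
have {pm pmne}pm : p%:R * nu < m%:R by rewrite lt_neqAle pmne.
have mpnu : 0 < m%:R - p%:R * nu by rewrite subr_gt0.
have E n : (n + p)%:R * nu - m%:R + 1 + (m%:R - p%:R * nu) = n%:R * nu + 1.
  by rewrite natrD; ring.
have [|||s /andP[s0 _]|fi] := fint_power_series (m%:R - p%:R * nu) (fun n => c (n + p)%N)
   (fun n => (n + p)%:R * nu - m%:R + 1) t (pos_part (derive1n m F)) mpnu t0.
- by move=> n; have := mnp n; rewrite ltrBlDr => ?; rewrite addrAC subr_gt0.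
- rewrite (_ : (fun n => _) = (fun n => `|c (n + p)%N / Gamma (n%:R * nu + 1) * (t `^ nu) ^+ n|)).
    exact: ed'.
  by apply/funext => n; rewrite E kpow_natM //; congr (`|_|); ring.
- by move=> s s0; rewrite /pos_part ltNge s0.
- by rewrite /pos_part s0; exact: dF.
under [in series _]eq_fun => n do rewrite E.
move=> /valE ->.
left; exists m; split.
- by rewrite mp.
- move=> i s im /andP[s0 _]; exact: (rpsum_derive1n nu _ i ed s s0).2.
- exact/caputo_integrable.
by rewrite caputo_integral.
Unshelve. all: by end_near. Qed.

End series_of_integrals.

(** * Closed form of the generating function *)

Section generating_function.
Context {R : realType}.

Lemma pochhammer_fact j r : pochhammer (j.+1%:R : R) r = (j + r)`!%:R / j`!%:R.
Proof.
rewrite /pochhammer; elim: r => [|r IH].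
  by rewrite big_ord0 addn0 divff // pnatr_eq0 -lt0n fact_gt0.
by rewrite big_ord_recr /= IH addnS factS natrM -natrD addSn mulrC mulrA.
Qed.

(** For the integer parameter [j + 1] the Pochhammer symbol divided by [r!] is a binomial
    coefficient. *)
Lemma mittag_leffler3E (nu b z : R) j :
  mittag_leffler3 nu b j.+1%:R z = psum (fun r => 'C(r + j, j)%:R / Gamma (r%:R * nu + b)) z.
Proof.
rewrite /mittag_leffler3 /psum (_ : (fun r => _) =
  (fun r => 'C(r + j, j)%:R / Gamma (r%:R * nu + b) * z ^+ r)) //.
apply/funext => r; rewrite pochhammer_fact (mulrC nu) addnC.
have -> : 'C(r + j, j)%:R = (r + j)`!%:R / (j`!%:R * r`!%:R) :> R.
  have := bin_fact (leq_addl r j); rewrite addnK => <-; rewrite !natrM mulfK //.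
rewrite !invfM; ring.
Qed.

Lemma mittag_lefflerE (nu z : R) :
  mittag_leffler nu 1 z = psum (fun r => (Gamma (r%:R * nu + 1))^-1) z.
Proof.
rewrite /mittag_leffler (mittag_leffler3E nu 1 z 0); congr (psum _ z).
by apply/funext => r; rewrite bin0 mul1r.
Qed.

Lemma sum_bin_le n J : (\sum_(0 <= j < J) 'C(n, j) <= 2 ^ n)%N.
Proof.
have E : (\sum_(0 <= j < n.+1) 'C(n, j) = 2 ^ n)%N.
  rewrite -[2%N]/(1 + 1)%N expnDn big_mkord; apply: eq_bigr => i _.
  by rewrite !exp1n !muln1.
rewrite -E; have [Jn|nJ] := leqP J n.+1; first by rewrite (big_cat_nat (leq0n J) Jn) /= leq_addr.
rewrite (big_cat_nat (leq0n n.+1) (ltnW nJ)) /= [X in (_ + X <= _)%N]big_nat_cond [X in (_ + X <= _)%N]big1 ?addn0 //.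
by move=> i /andP[/andP[ni _] _]; rewrite bin_small.
Qed.

Lemma bin_le_exp2 n j : ('C(n, j) <= 2 ^ n)%N.
Proof. by apply: leq_trans (sum_bin_le n j.+1); rewrite big_nat_recr //= leq_addl. Qed.

Section fixed_time.
Variables (lambda nu t : R).
Hypothesis nu0 : 0 < nu.

Let y n : R := (lambda * t `^ nu) ^+ n / Gamma (n%:R * nu + 1).

Lemma entire_shift (d : nat -> R) j : entire d -> entire (fun n => d (n + j)%N).
Proof.
move=> ed; elim: j => [|j IH]; first by under eq_fun do rewrite addn0.
by under eq_fun do rewrite addnS -addSn; exact: (entireS _ IH).
Qed.

(** Reindexing by [n = r + j] absorbs the prefactor. The terms with [n < j] vanish with the binomial
    coefficient, so the truncated subtraction [n - j] is harmless. *)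
Lemma phat_term j :
  series (fun n => 'C(n, j)%:R * (-1) ^+ (n - j) * y n) @ \oo -->
  lambda ^+ j * t `^ (j%:R * nu) *
    mittag_leffler3 nu (j%:R * nu + 1) j.+1%:R (- lambda * t `^ nu).
Proof.
rewrite mittag_leffler3E.
pose e r : R := 'C(r + j, j)%:R / Gamma (r%:R * nu + (j%:R * nu + 1)); rewrite -/e.
have ee : entire e.
  have := entire_shift _ j (entire_invGamma nu nu0).
  apply: (@entire_le _ _ _ (2 ^+ j) 2) => // n.
  rewrite /e natrD mulrDl addrA normrM ler_wpM2r // normr_nat -natrX -natrX -natrM ler_nat.
  by rewrite -expnD addnC bin_le_exp2.
have /(series_cvgZ _ (lambda ^+ j * t `^ (j%:R * nu))) := entire_cvg _ (- lambda * t `^ nu) ee.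
set g := fun n : nat => _ * y n.
have g0 i : (i < j)%N -> g i = 0 by move=> ij; rewrite /g (bin_small ij) mulr0n !mul0r.
move=> H; apply: (series_cvg_shift g j _ g0).1.
rewrite (_ : (fun n => g _) = (fun n => lambda ^+ j * t `^ (j%:R * nu) * (e n * (- lambda * t `^ nu) ^+ n))) //.
apply/funext => n; rewrite /g /e /y addnK powR_natM (natrD _ n) mulrDl addrA.
by rewrite mulNr (exprNn (lambda * _)) !exprMn !exprD; ring.
Qed.

End fixed_time.

(** Tannery's theorem along a reindexing [f]. As [a n (f K)] and [b n] agree for [n < K], their sums
    differ by at most twice the tail of [M] from [K] on. *)
Lemma tannery (a : nat -> nat -> R) (b M : nat -> R) (lJ : nat -> R) (l : R) :
  (forall n J, `|a n J| <= M n) -> (forall n, `|b n| <= M n) ->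
  (forall n J, (n < J)%N -> a n J = b n) -> cvgn (series M) ->
  (forall J, series (a ^~ J) @ \oo --> lJ J) -> series b @ \oo --> l ->
  forall f : nat -> nat, (forall K, (K <= f K)%N) -> lJ (f K) @[K --> \oo] --> l.
Proof.
move=> aM bM ab cM alJ bl f fK.
have M0 n : 0 <= M n by exact: le_trans (bM n).
have sM K : series M K <= limn (series M).
  apply: nondecreasing_cvgn_le => // m n mn; rewrite /series /=.
  by rewrite (big_cat_nat (leq0n m) mn) /= lerDl sumr_ge0.
have bound K : `|lJ (f K) - l| <= 2 * (limn (series M) - series M K).
  have : (fun N => series (a ^~ (f K)) N - series b N) @ \oo --> lJ (f K) - l by exact: cvgB.
  move=> /cvg_norm H.
  rewrite -(cvg_lim _ H) //; apply: limr_le; first by apply/cvg_ex; eexists; exact: H.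
  exists K => //= N KN; rewrite /series /= -sumrB (big_cat_nat (leq0n K) KN) /=.
  rewrite big_nat_cond big1 ?add0r; last first.
    move=> i /andP[/andP[_ iK] _]; rewrite ab ?subrr //.
    exact: leq_trans iK (fK K).
  apply: le_trans (ler_norm_sum _ _ _) _.
  apply: (@le_trans _ _ (\sum_(K <= i < N) 2 * M i)).
    apply: ler_sum => i _; apply: le_trans (ler_normB _ _) _.
    by rewrite mulr_natl mulr2n lerD.
  rewrite -mulr_sumr ler_wpM2l // lerBrDl.
  have := sM N; rewrite {1}/series /= (big_cat_nat (leq0n K) KN) //=.
apply/cvgrPdist_le => /= e e0.
have := cM; move=> /cvgrPdist_le /(_ (e / 2)); rewrite divr_gt0 // => /(_ isT)[K _ HK].
exists K => //= n Kn; rewrite distrC (le_trans (bound n)) //.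
rewrite mulrC -ler_pdivlMr //.
by have := HK n Kn; apply: le_trans; exact: ler_norm.
Qed.

Section coefficients.
Variables (lambda nu v : R).
Hypotheses (lambda0 : 0 < lambda) (nu0 : 0 < nu) (v01 : 0 < v <= 1).

Let v0 : v != 0. Proof. by have /andP[/gt_eqF->] := v01. Qed.

Definition gf_weight j : R := (v ^+ 2) ^+ j./2.

Definition gf_coef n : R :=
  (v + 1) / (2 * v) * (- lambda * (1 - v)) ^+ n + (v - 1) / (2 * v) * (- lambda * (1 + v)) ^+ n.

(** The two constants add up to 1, which settles even [j]; their difference is [1 / v], which turns
    an odd power of [v] into the even power below it. *)
Lemma gf_weightE j :
  gf_weight j = (v + 1) / (2 * v) * v ^+ j + (v - 1) / (2 * v) * (- v) ^+ j.
Proof.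
rewrite /gf_weight -[in RHS](odd_double_half j); move: (j./2) => m.
have vm : (- v) ^+ m.*2 = (v ^+ 2) ^+ m by rewrite -mul2n exprM sqrrN.
have vm' : v ^+ m.*2 = (v ^+ 2) ^+ m by rewrite -mul2n exprM.
case: (odd j); rewrite ?add1n ?add0n ?(exprS _ m.*2) vm vm'; move: (v ^+ 2 ^+ m) => p.
  by field; exact: v0.
by field; exact: v0.
Qed.

Lemma gf_weight_le1 j : 0 <= gf_weight j <= 1.
Proof.
have /andP[v_gt0 v_le1] := v01.
by rewrite /gf_weight !exprn_ge0 ?(ltW v_gt0) //= !exprn_ile1 ?exprn_ge0 ?(ltW v_gt0) ?exprn_ile1 ?(ltW v_gt0).
Qed.

Lemma gf_coef_binomial n :
  gf_coef n = lambda ^+ n * \sum_(j < n.+1) gf_weight j * ('C(n, j)%:R * (-1) ^+ (n - j)).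
Proof.
have E (x : R) : (-1 + x) ^+ n = \sum_(j < n.+1) x ^+ j * ('C(n, j)%:R * (-1) ^+ (n - j)).
  by rewrite exprDn; apply: eq_bigr => j _; rewrite -mulr_natr; ring.
rewrite (_ : \sum_(_ < _) _ = (v + 1) / (2 * v) * (-1 + v) ^+ n + (v - 1) / (2 * v) * (-1 - v) ^+ n).
  rewrite mulrDr !(mulrCA (lambda ^+ n)) -!exprMn /gf_coef; congr (_ * _ ^+ _ + _ * _ ^+ _); ring.
rewrite !E !mulr_sumr -big_split /=; apply: eq_bigr => j _.
by rewrite gf_weightE; ring.
Qed.

Lemma gf_coef_bound n : `|gf_coef n| <= (`|(v + 1) / (2 * v)| + `|(v - 1) / (2 * v)|) * (2 * lambda) ^+ n.
Proof.
have /andP[v_gt0 v_le1] := v01.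
rewrite /gf_coef; apply: le_trans (ler_normD _ _) _; rewrite [leRHS]mulrDl; apply: lerD.
  rewrite normrM ler_wpM2l // normrX lerXn2r ?nnegrE ?mulr_ge0 ?(ltW lambda0) //.
  rewrite normrM normrN (gtr0_norm lambda0) mulrC ler_wpM2r ?(ltW lambda0) //.
  by rewrite ger0_norm; lra.
rewrite normrM ler_wpM2l // normrX lerXn2r ?nnegrE ?mulr_ge0 ?(ltW lambda0) //.
rewrite normrM normrN (gtr0_norm lambda0) mulrC ler_wpM2r ?(ltW lambda0) //.
by rewrite ger0_norm; lra.
Qed.

Lemma gf_coef0 : gf_coef 0 = 1.
Proof. by rewrite /gf_coef !expr0; field; exact: v0. Qed.

(** This vanishing lets the Caputo derivative of order [2 nu] act as a shift by two, and it removes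
    the term in [t^nu], whose derivative at 0 would be infinite for [nu < 1]. *)
Lemma gf_coef1 : gf_coef 1 = 0.
Proof. by rewrite /gf_coef !expr1; field; exact: v0. Qed.

(** The ratios [- lambda * (1 - v)] and [- lambda * (1 + v)] are the roots of
    [r^2 + 2 lambda r = lambda^2 (v^2 - 1)]. *)
Lemma gf_coef_rec n :
  gf_coef n.+2 + 2 * lambda * gf_coef n.+1 = lambda ^+ 2 * (v ^+ 2 - 1) * gf_coef n.
Proof. rewrite /gf_coef !exprS; move: (_ ^+ n) (_ ^+ n) => p q; field; exact: v0. Qed.

Definition gf_series := fun n => gf_coef n / Gamma (n%:R * nu + 1).

Lemma entire_gf_series : entire gf_series.
Proof.
by apply: entire_mittag_leffler gf_coef_bound => //; rewrite mulr_ge0 // ltW.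
Qed.

Lemma gf_series_mittag_leffler z : psum gf_series z =
  (v + 1) / (2 * v) * mittag_leffler nu 1 (- lambda * (1 - v) * z) +
  (v - 1) / (2 * v) * mittag_leffler nu 1 (- lambda * (1 + v) * z).
Proof.
have eG := entire_invGamma nu nu0.
rewrite !mittag_lefflerE; apply/cvg_lim => //.
rewrite (_ : (fun n => _) = (fun n =>
  (v + 1) / (2 * v) * ((Gamma (n%:R * nu + 1))^-1 * (- lambda * (1 - v) * z) ^+ n) +
  (v - 1) / (2 * v) * ((Gamma (n%:R * nu + 1))^-1 * (- lambda * (1 + v) * z) ^+ n))).
  by apply: series_cvgD; apply: series_cvgZ; exact: entire_cvg.
by apply/funext => n; rewrite /gf_series /gf_coef ![(_ * z) ^+ n]exprMn; ring.
Qed.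

Lemma phat_weight k t : (v ^+ 2) ^+ k * phat lambda nu k t =
  \sum_(j <- [:: (2 * k)%N; (2 * k + 1)%N]) gf_weight j *
    (lambda ^+ j * t `^ (j%:R * nu) * mittag_leffler3 nu (j%:R * nu + 1) j.+1%:R (- lambda * t `^ nu)).
Proof.
rewrite /phat big_cons big_seq1 /gf_weight mul2n doubleK addn1 /= uphalf_double.
by rewrite mulrDr addn2.
Qed.

Lemma Ghat_series_cvg t :
  Ghat_series lambda nu (v ^+ 2) t @ \oo --> psum gf_series (t `^ nu).
Proof.
pose x := lambda * t `^ nu; have x0 : 0 <= x by rewrite mulr_ge0 ?powR_ge0 // ltW.
pose y n := x ^+ n / Gamma (n%:R * nu + 1).
have y0 n : 0 <= y n.
  by rewrite divr_ge0 ?exprn_ge0 // ltW // Gamma_gt0 // ltr_wpDl // mulr_ge0 // ltW.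
pose T j := lambda ^+ j * t `^ (j%:R * nu) *
  mittag_leffler3 nu (j%:R * nu + 1) j.+1%:R (- lambda * t `^ nu).
(* The part of the order [n] term that comes from the first [J] Mittag-Leffler terms; it is constant
   once [J > n], since ['C(n, j)] vanishes for [j > n]. *)
pose a n J := (\sum_(j < J) gf_weight j * ('C(n, j)%:R * (-1) ^+ (n - j))) * y n.
have aM n J : `|a n J| <= 2 ^+ n * y n.
  rewrite normrM (ger0_norm (y0 n)) ler_wpM2r //.
  apply: le_trans (ler_norm_sum _ _ _) _.
  apply: (@le_trans _ _ (\sum_(j < J) 'C(n, j)%:R)).
    apply: ler_sum => j _; have /andP[w0 w1] := gf_weight_le1 j.
    by rewrite !normrM normr_sign mulr1 normr_nat (ger0_norm w0) ler_piMl.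
  by rewrite -natr_sum -natrX ler_nat -(big_mkord xpredT (fun j => 'C(n, j))) sum_bin_le.
have aJ J : series (a ^~ J) @ \oo --> \sum_(j < J) gf_weight j * T j.
  elim: J => [|J IH].
    rewrite big_ord0 (_ : (fun n => _) = (fun n => 0)); first exact: series_cvg0.
    by apply/funext => n; rewrite /a big_ord0 mul0r.
  rewrite big_ord_recr /= (_ : (fun n => _) = (fun n => a n J +
      gf_weight J * ('C(n, J)%:R * (-1) ^+ (n - J) * y n))).
    by apply: series_cvgD => //; apply: series_cvgZ; exact: phat_term.
  by apply/funext => n; rewrite /a big_ord_recr /=; ring.
have ab n J : (n < J)%N -> a n J = a n n.+1.
  move=> nJ; rewrite /a; congr (_ * _).
  rewrite -!(big_mkord xpredT (fun j => gf_weight j * ('C(n, j)%:R * (-1) ^+ (n - j)))).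
  rewrite (big_cat_nat (leq0n n.+1) nJ) /= [X in _ + X]big_nat_cond [X in _ + X]big1 ?addr0 //.
  by move=> i /andP[/andP[ni _] _]; rewrite bin_small // mul0r mulr0.
have bl : series (fun n => a n n.+1) @ \oo --> psum gf_series (t `^ nu).
  rewrite (_ : (fun n => _) = (fun n => gf_series n * (t `^ nu) ^+ n)).
    exact: entire_cvg entire_gf_series.
  by apply/funext => n; rewrite /gf_series gf_coef_binomial /a /y /x exprMn; ring.
have cM : cvgn (series (fun n => 2 ^+ n * y n)).
  have := entire_invGamma nu nu0 (2 * x).
  rewrite (_ : (fun n => `|_|) = (fun n => 2 ^+ n * y n)) //.
  apply/funext => n; rewrite ger0_norm; first by rewrite exprMn /y; ring.
  apply: mulr_ge0; last by rewrite exprn_ge0 // mulr_ge0.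
  by rewrite invr_ge0 ltW // Gamma_gt0 // ltr_wpDl // mulr_ge0 // ltW.
(* The first [K] terms of [Ghat_series] collect [2 K] Mittag-Leffler terms. *)
have := tannery a (fun n => a n n.+1) _ _ _ aM (fun n => aM n n.+1) ab cM aJ bl (fun K => (2 * K)%N) _.
rewrite (_ : (fun K => _) = Ghat_series lambda nu (v ^+ 2) t).
  by apply => K; rewrite leq_pmull.
apply/funext => K; rewrite /Ghat_series /series /=; elim: K => [|K IH].
  by rewrite muln0 big_ord0 big_nil.
rewrite big_nat_recr //= -IH mulnS addnC addn2 !big_ord_recr /= phat_weight.
by rewrite big_cons big_seq1 addn1 addrA.
Qed.

End coefficients.

End generating_function.

(** * The generating function solves the initial value problem *)

Section existence.
Context {R : realType}.

Lemma rpsum0E (nu : R) d t : rpsum nu 0 d t = psum d (t `^ nu).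
Proof. by rewrite /rpsum powRr0 mul1r. Qed.

Lemma psum_continuous (d : nat -> R) : entire d -> continuous (psum d).
Proof.
move=> ed x; apply: differentiable_continuous; apply/derivable1_diffP.
by have [] := psum_is_derive d x ed.
Qed.

Lemma psum_powR_cvg0 (nu : R) d : 0 < nu -> entire d ->
  psum d (t `^ nu) @[t --> 0^'+] --> d 0%N.
Proof.
move=> nu0 ed; rewrite -(psum0 d).
by apply: cvg_comp (powR_cvg0 nu0) (psum_continuous d ed 0).
Qed.

Lemma rpsum_within_continuous (nu : R) d : 0 < nu -> entire d ->
  {within `[0, +oo[, continuous (rpsum nu 0 d)}.
Proof.
move=> nu0 ed; apply/continuous_within_itvcyP; split.
  move=> t; rewrite in_itv /= andbT => t0.
  apply: differentiable_continuous; apply/derivable1_diffP.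
  by have [] := rpsum_is_derive nu 0 d t ed t0.
rewrite (_ : rpsum nu 0 d = (fun t => psum d (t `^ nu))); last first.
  by apply/funext => t; exact: rpsum0E.
by rewrite powR0 ?gt_eqF // psum0; exact: psum_powR_cvg0.
Qed.

Variables (lambda nu v : R).
Hypotheses (lambda0 : 0 < lambda) (nu01 : 0 < nu <= 1) (v01 : 0 < v <= 1).

Let nu0 : 0 < nu. Proof. by have /andP[] := nu01. Qed.

Lemma GhatE : Ghat lambda nu (v ^+ 2) = rpsum nu 0 (gf_series lambda nu v).
Proof.
apply/funext => t; rewrite rpsum0E /Ghat.
by apply/cvg_lim => //; exact: Ghat_series_cvg.
Qed.

Lemma Ghat_caputo (p m : nat) t : (0 < p)%N -> (p <= 2)%N ->
  m%:R - 1 < p%:R * nu <= m%:R -> 0 < t ->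
  is_caputo (p%:R * nu) (rpsum nu 0 (gf_series lambda nu v)) t
    (psum (fun n => gf_coef lambda v (n + p) / Gamma (n%:R * nu + 1)) (t `^ nu)).
Proof.
move=> p0 p2 mp t0; rewrite -rpsum0E.
apply: is_caputo_rpsum (gf_coef_bound lambda v lambda0 v01) _ _ mp t0 => //.
  by rewrite mulr_ge0 // ltW.
case=> [|[|n]] //; first by rewrite gf_coef1.
by move=> /andP[_ np]; have := leq_trans np p2.
Qed.

Lemma Ghat_is_solution : is_solution lambda nu (v ^+ 2) (Ghat lambda nu (v ^+ 2)).
Proof.
rewrite GhatE.
have /andP[_ nu1] := nu01.
have eG : entire (gf_series lambda nu v) by exact: entire_gf_series.
have G0 : gf_series lambda nu v 0 = 1 by rewrite /gf_series gf_coef0 // mul0r add0r Gamma_one divr1.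
have G1 : gf_series lambda nu v 1 = 0 by rewrite /gf_series gf_coef1 // mul0r.
have eS p : entire (fun n => gf_coef lambda v (n + p) / Gamma (n%:R * nu + 1)).
  apply: (@entire_mittag_leffler _ _ _ _ (2 * lambda)) => //.
    by rewrite mulr_ge0 // ltW.
  move=> n; apply: le_trans (gf_coef_bound _ _ lambda0 v01 _) _.
  by rewrite exprD mulrA mulrAC.
split.
- exact: rpsum_within_continuous.
- move=> t t0.
  exists (psum (fun n => gf_coef lambda v (n + 2) / Gamma (n%:R * nu + 1)) (t `^ nu)).
  exists (psum (fun n => gf_coef lambda v (n + 1) / Gamma (n%:R * nu + 1)) (t `^ nu)).
  split.
  (* One or two ordinary derivatives enter the Caputo derivative, according to the side of 1 on
     which [2 * nu] lies. *)
  + have [nu12|nu12] := leP (2 * nu) 1.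
      by apply: (Ghat_caputo 2 1) => //; rewrite subrr nu12 mulr_gt0.
    apply: (Ghat_caputo 2 2) => //.
    by apply/andP; split; lra.
  + by have := Ghat_caputo 1 1 t; rewrite mul1r; apply => //; rewrite subrr nu0.
  + rewrite rpsum0E; apply/esym.
    have E2 := entire_cvg _ (t `^ nu) (eS 2%N).
    have E1 := entire_cvg _ (t `^ nu) (eS 1%N).
    have E0 := series_cvgZ _ (lambda ^+ 2 * (v ^+ 2 - 1)) _ (entire_cvg _ (t `^ nu) eG).
    apply: cvg_unique E0 _ => //.
    rewrite (_ : (fun n => _) = (fun n =>
        gf_coef lambda v (n + 2) / Gamma (n%:R * nu + 1) * t `^ nu ^+ n +
        2 * lambda * (gf_coef lambda v (n + 1) / Gamma (n%:R * nu + 1) * t `^ nu ^+ n))).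
      by apply: series_cvgD => //; apply: series_cvgZ.
    apply/funext => n; rewrite /gf_series addn1 addn2.
    rewrite mulrA mulrA -gf_coef_rec //; ring.
- by rewrite rpsum0E powR0 ?gt_eqF // psum0.
- move=> nu12.
  pose d2 n := gf_series lambda nu v (n + 2).
  have ed2 : entire d2 by exact: entire_shift.
  (* As the coefficients of index 0 and 1 are 1 and 0, the difference quotient starts at
     [h^(2 nu - 1)], which tends to 0 for [1 / 2 < nu]. *)
  have E h : 0 < h -> h^-1 * (rpsum nu 0 (gf_series lambda nu v) h - rpsum nu 0 (gf_series lambda nu v) 0)
      = h `^ (2 * nu - 1) * psum d2 (h `^ nu).
    move=> h0; rewrite !rpsum0E powR0 ?gt_eqF // psum0 G0.
    have -> : psum (gf_series lambda nu v) (h `^ nu) = 1 + h `^ nu ^+ 2 * psum d2 (h `^ nu).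
      apply/cvg_lim => //.
      pose r n := if (n < 2)%N then 0 else gf_series lambda nu v n * h `^ nu ^+ n.
      pose q n : R := if n is 0%N then 1 else 0.
      rewrite (_ : (fun n => _) = (fun n => q n + r n)); last first.
        apply/funext => -[|[|n]]; rewrite /q /r /=.
        - by rewrite G0 expr0 mulr1 addr0.
        - by rewrite G1 mul0r addr0.
        - by rewrite add0r.
      apply: series_cvgD.
        apply: cvg_near_cst; exists 1%N => //= n n1.
        by rewrite /series /= -(prednK n1) big_nat_recl //= big1 ?addr0.
      apply: (series_cvg_shift r 2 _ _).1; first by move=> i i2; rewrite /r i2.
      rewrite (_ : (fun n => _) = (fun n => h `^ nu ^+ 2 * (d2 n * h `^ nu ^+ n))).
        by apply: series_cvgZ; exact: entire_cvg.
      by apply/funext => n; rewrite /r /d2 addn2 /= !exprS; ring.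
    rewrite addrC addrA (addrC _ 1) subrr add0r mulrA; congr (_ * _).
    rewrite -powR_natM powRDgt0 // mulrC; congr (_ * _).
    by rewrite powR_inv1 // ltW.
  rewrite -[X in _ --> X](mul0r (d2 0%N)).
  have C : h `^ (2 * nu - 1) * psum d2 (h `^ nu) @[h --> 0^'+] --> 0 * d2 0%N.
    apply: cvgM; last exact: psum_powR_cvg0.
    by apply: powR_cvg0; lra.
  apply: cvg_trans C; apply: near_eq_cvg.
  near=> h; apply/esym/E; near: h; exact: nbhs_right_gt.
Unshelve. all: by end_near. Qed.

End existence.

(** * Exponentially weighted bounds and the Volterra equation *)

Section fractional_bounds.
Context {R : realType}.
Local Notation mu := (@lebesgue_measure R).

(** The exponential is an eigenfunction of the fractional integral based at minus infinity, with
    eigenvalue [K^(-a)]; this decay in [K] is the source of the contraction. *)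
Lemma kint_exp_integral (a K t : R) : 0 < a -> 0 < K ->
  (\int[mu]_x (kpow a (t - x) * expR (K * x))%:E = (Gamma a * K `^ (- a) * expR (K * t))%:E)%E.
Proof.
move=> a0 K0.
have me : measurable_fun [set: R] (fun y : R => expR (- (K * y))).
  apply: (measurableT_comp (f := fun y : R => expR (- y))); first exact: measurable_expRN.
  exact: measurable_funM.
pose g y := (kpow a y * expR (- (K * y)))%:E.
have mg : measurable_fun [set: R] g.
  by apply/measurable_EFinP; apply: measurable_funM => //; exact: measurable_kpow.
have g0 y : (0 <= g y)%E by rewrite lee_fin mulr_ge0 ?kpow_ge0 ?expR_ge0.
transitivity ((expR (K * t))%:E * \int[mu]_x g (t - x)%R)%E.
  rewrite -ge0_integralZl ?lee_fin ?expR_ge0 //; last first.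
    by apply: (measurableT_comp mg); apply: measurable_funB.
  apply: eq_integral => x _; rewrite /g -EFinM; congr EFin.
  rewrite mulrCA -expRD; congr (_ * expR _); ring.
rewrite ge0_integral_reflect // muleC EFinM; congr (_ * _)%E.
rewrite -(ge0_integral_affine _ K^-1 0) ?invr_gt0 //.
have -> : (\int[mu]_x g (K^-1 * x + 0)%R = (K^-1 `^ (a - 1))%:E * gammaE a)%E.
  rewrite /gammaE -ge0_integralZl ?lee_fin ?powR_ge0 //; last 2 first.
  - apply/measurable_EFinP; apply: measurable_funM; first exact: measurable_kpow.
    exact: measurable_expRN.
  - by move=> x _; rewrite lee_fin mulr_ge0 ?kpow_ge0 ?expR_ge0.
  apply: eq_integral => x _; rewrite /g addr0 kpow_scale ?invr_gt0 // -EFinM mulVKf ?gt_eqF //.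
  by rewrite mulrA.
rewrite GammaEFin // muleA -!EFinM mulrC; congr (_ * _)%:E.
rewrite -[K^-1]powR_inv1 ?ltW // -powRrM -powRDgt0 //; congr (_ `^ _); ring.
Qed.

Lemma fint_exp_bound (a K t M : R) (f : R -> R) : 0 < a -> 0 < K ->
  kintegrable a f t -> (forall x, x < t -> `|f x| <= M * expR (K * x)) -> 
  `|fint a f t| <= M * K `^ (- a) * expR (K * t).
Proof.
move=> a0 K0 fi fM.
have G0 : 0 < Gamma a by exact: Gamma_gt0.
rewrite /fint normrM [`|_^-1|]ger0_norm ?invr_ge0 ?(ltW G0) // [leLHS]mulrC ler_pdivrMr //.
have M0 : 0 <= M.
  have := le_trans (normr_ge0 _) (fM (t - 1) _); rewrite ltrBlDr ltrDl ltr01.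
  by move=> /(_ isT); rewrite pmulr_lge0 // expR_gt0.
apply: le_trans (le_normr_Rintegral _ _) _ => //.
rewrite -lee_fin /Rintegral fineK; last first.
  by apply: integrable_fin_num => //; exact: integrable_norm.
have mk : measurable_fun [set: R] (fun x => kpow a (t - x) * expR (K * x)).
  apply: measurable_funM; first exact: measurable_kpow_sub.
  by apply: measurableT_comp; [exact: measurable_expR|apply: measurable_funM].
apply: (@le_trans _ _ (\int[mu]_x (M%:E * (kpow a (t - x) * expR (K * x))%:E))%E); last first.
  rewrite ge0_integralZl //; last 2 first.
  - by apply/measurable_EFinP; exact: mk.
  - by move=> x _; rewrite lee_fin mulr_ge0 ?kpow_ge0 ?expR_ge0.
  rewrite kint_exp_integral // -EFinM lee_fin le_eqVlt; apply/orP; left; apply/eqP; ring.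
apply: ge0_le_integral => //.
- have /measurable_int /measurable_EFinP mki := fi.
  by apply/measurable_EFinP; apply: measurableT_comp.
- by apply: measurable_funeM; apply/measurable_EFinP; exact: mk.
- move=> x _; rewrite -EFinM lee_fin /kint normrM ger0_norm ?kpow_ge0 // mulrCA.
  have [tx|xt] := leP t x; first by rewrite kpow_le0 ?mul0r // subr_le0.
  by rewrite ler_wpM2l ?kpow_ge0 // fM.
Qed.

(* The weight [expR (- K x)] makes [fint a] a strict contraction for large [K]. *)
Lemma volterra_unique (a b p q : R) (H : R -> R) : 0 < a -> 0 < b -> 0 <= p -> 0 <= q ->
  {within `[0, +oo[, continuous H} -> H 0 = 0 ->
  (forall t : R, 0 < t -> kintegrable a (pos_part H) t) ->
  (forall t : R, 0 < t -> kintegrable b (pos_part (fun x => q * H x)) t) ->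
  (forall t : R, 0 < t -> H t + p * fint a (pos_part H) t + fint b (pos_part (fun x => q * H x)) t = 0) ->
  forall t, 0 <= t -> H t = 0.
Proof.
move=> a0 b0 p0 q0 cH H0 ai bi HH T T0.
have [T0'|T0'] := leP T 0; first by have -> : T = 0 by apply/le_anti; rewrite T0' T0.
pose d := Num.min a b; have d0 : 0 < d by rewrite lt_min a0.
(* [K] is such that [K^(-a)] and [K^(-b)] are at most [1 / B], so the contraction factor is
   [(p + q) / B < 1]. As [K >= 1], the smaller order [d] decides. *)
pose B := p + q + 1; have B1 : 1 <= B by rewrite lerDr addr_ge0.
have B0 : 0 < B by exact: lt_le_trans B1.
pose K := B `^ d^-1; have K0 : 0 < K by rewrite powR_gt0.
have K1 : 1 <= K by rewrite -(powRr0 B) ler_powR // invr_ge0 ltW.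
have Kc c : d <= c -> K `^ (- c) <= B^-1.
  move=> dc; rewrite (@le_trans _ _ (K `^ (- d))) ?ler_powR ?lerN2 //.
  by rewrite /K -powRrM mulrN mulVf ?gt_eqF // powR_inv1 // ltW.
have Ka : K `^ (- a) <= B^-1 by apply: Kc; rewrite ge_min lexx.
have Kb : K `^ (- b) <= B^-1 by apply: Kc; rewrite ge_min lexx orbT.
pose phi t := expR (- (K * t)) * `|H t|.
have cphi : {within `[0, T], continuous phi}.
  have cHT : {within `[0, T], continuous H}.
    by apply: continuous_subspaceW cH => x /=; rewrite !in_itv /= andbT => /andP[].
  move=> x; apply: cvgM; last by apply: cvg_norm; exact: cHT.
  apply: (continuous_subspaceT (f := fun t : R => expR (- (K * t)))) => y.
  apply: continuous_comp; last exact: continuous_expR.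
  by apply: cvgN; apply: cvgMr; exact: cvg_id.
(* The weighted norm on [[0, T]] is attained at [c], and the equation at [c] bounds [phi c] by a
   proper fraction of itself. *)
have [c] := EVT_max T0 cphi.
rewrite in_itv /= => /andP[c0 cT] phic.
have M0 : 0 <= phi c by rewrite mulr_ge0 ?expR_ge0.
have bound x : 0 <= x <= T -> `|H x| <= phi c * expR (K * x).
  move=> xT; rewrite -ler_pdivrMr ?expR_gt0 // -expRN mulrC; apply: phic.
  by rewrite in_itv.
suff M1 : phi c <= 0.
  have := bound T; rewrite T0 lexx => /(_ isT).
  have -> : phi c = 0 by apply/le_anti; rewrite M1 M0.
  by rewrite mul0r normr_le0 => /eqP.
have [c0'|c0'] := leP c 0.
  by have -> : c = 0 by [apply/le_anti; rewrite c0 c0']; rewrite /phi H0 normr0 mulr0.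
have bH x : x < c -> `|pos_part H x| <= phi c * expR (K * x).
  move=> xc; rewrite /pos_part; case: ltP => x0; last by rewrite normr0 mulr_ge0 ?expR_ge0.
  by apply: bound; rewrite (ltW x0) (le_trans (ltW xc)).
have bqH x : x < c -> `|pos_part (fun x => q * H x) x| <= q * phi c * expR (K * x).
  move=> xc; have := bH x xc; rewrite /pos_part; case: ltP => x0 Hx.
    by rewrite normrM (ger0_norm q0) -mulrA ler_wpM2l.
  by rewrite normr0 !mulr_ge0 ?expR_ge0.
have A1 := fint_exp_bound _ _ _ _ _ a0 K0 (ai c c0') bH.
have A2 := fint_exp_bound _ _ _ _ _ b0 K0 (bi c c0') bqH.
have Hc : `|H c| <= (p * B^-1 + q * B^-1) * phi c * expR (K * c).
  have -> : H c = - (p * fint a (pos_part H) c + fint b (pos_part (fun x => q * H x)) c).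
    by apply/eqP; rewrite -addr_eq0 addrA; apply/eqP; exact: HH.
  rewrite normrN; apply: le_trans (ler_normD _ _) _.
  rewrite normrM (ger0_norm p0) -mulrA mulrDl; apply: lerD.
    rewrite -mulrA ler_wpM2l //; apply: le_trans A1 _.
    by rewrite mulrA ler_wpM2r ?expR_ge0 // mulrC ler_wpM2r.
  apply: le_trans A2 _.
  by rewrite mulrA ler_wpM2r ?expR_ge0 // mulrAC ler_wpM2r // ler_wpM2l.
have {}Hc : phi c <= (p * B^-1 + q * B^-1) * phi c.
  by rewrite {1}/phi mulrC -ler_pdivlMr ?expR_gt0 // -expRN opprK.
have Bi : 0 < B^-1 by rewrite invr_gt0.
have E : 1 - (p * B^-1 + q * B^-1) = B^-1.
  by rewrite /B; field; rewrite gt_eqF.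
have : (1 - (p * B^-1 + q * B^-1)) * phi c <= 0 by rewrite mulrBl mul1r subr_le0.
by rewrite E pmulr_rle0.
Qed.

End fractional_bounds.

(** * Integrability near 0 and the fundamental theorem on the half-line *)

Section half_line_FTC.
Context {R : realType}.
Local Notation mu := (@lebesgue_measure R).

Lemma pos_part_le0 (w : R -> R) x : x <= 0 -> pos_part w x = 0.
Proof. by rewrite /pos_part leNgt => /negbTE ->. Qed.

Lemma pos_part_gt0 (w : R -> R) x : 0 < x -> pos_part w x = w x.
Proof. by rewrite /pos_part => ->. Qed.

Lemma kint_le0 (a : R) (w : R -> R) t : t <= 0 -> kint a (pos_part w) t = (fun=> 0).
Proof.
move=> t0; apply/funext => x; have [xt|xt] := ltP x t; last by rewrite kint_ge.
by rewrite /kint pos_part_le0 ?mulr0 // (le_trans (ltW xt)).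
Qed.

Lemma kintegrable_le0 (a : R) (w : R -> R) t : t <= 0 -> kintegrable a (pos_part w) t.
Proof. by move=> t0; rewrite /kintegrable kint_le0 //; exact: integrable0. Qed.

Lemma fint_le0 (a : R) (w : R -> R) t : t <= 0 -> fint a (pos_part w) t = 0.
Proof.
by move=> t0; rewrite /fint kint_le0 // /Rintegral integral0 mulr0.
Qed.

Lemma locint_integrable (W : R -> R) t : locally_integrable_pos W ->
  mu.-integrable `[0, t] (EFin \o W).
Proof.
move=> [_ W0 Wi].
have : mu.-integrable `[0, t] (EFin \o kint 1 W (t + 1)) by apply: integrableS (Wi (t + 1)).
apply: eq_integrable => // x; rewrite inE /= in_itv /= => /andP[_ xt].
by rewrite /kint kpow1 subr_gt0 (le_lt_trans xt) ?ltrDl // mul1r.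
Qed.

Lemma fint1E (W : R -> R) t : locally_integrable_pos W -> 
  fint 1 W t = \int[mu]_(x in `[0, t]) W x.
Proof.
move=> lW; have [_ W0 _] := lW; rewrite /fint Gamma_one invr1 mul1r.
rewrite -Rintegral_itv_bndo_bndc; last first.
  by apply: integrableS (locint_integrable _ t lW) => // x /=; rewrite !in_itv /= => /andP[-> /ltW].
rewrite [RHS]Rintegral_mkcond; apply: eq_Rintegral => x _.
rewrite /kint kpow1 patchE mem_setE in_itv /= subr_gt0.
have [x0|x0] := leP 0 x; first by case: ltP => xt; rewrite ?mul1r ?mul0r.
by rewrite W0 ?mulr0 // ltW.
Qed.

(** The fundamental theorem applies between positive points; integrability down to 0 makes the
    integral over [[0, s]] tend to 0, which produces the limit [L], computed from the value at 1. *)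
Lemma half_line_FTC (f w : R -> R) : (forall t : R, 0 < t -> is_derive t 1 f (w t)) ->
  locally_integrable_pos (pos_part w) ->
  exists2 L : R, f s @[s --> 0^'+] --> L & forall t : R, 0 < t -> f t = L + fint 1 (pos_part w) t.
Proof.
move=> df lw; set W := pos_part w.
pose J s := \int[mu]_(x in `[0, s]) W x.
have JB s t : 0 < s -> s <= t -> f t - f s = J t - J s.
  move=> s0 st.
  have -> : f t - f s = \int[mu]_(x in `[s, t]) W x.
    apply: derivable_FTC => //.
      move=> x /andP[sx _]; have x0 := lt_le_trans s0 sx.
      by rewrite /W pos_part_gt0 //; exact: df.
    apply: integrableS (locint_integrable _ t lw) => // x /=; rewrite !in_itv /= => /andP[sx ->].
    by rewrite (le_trans (ltW s0)).
  rewrite /J Rintegral_itvB ?bnd_simp ?(ltW s0) //; last exact: locint_integrable.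
  rewrite Rintegral_itv_obnd_cbnd //.
  apply: integrableS (locint_integrable _ t lw) => // x /=; rewrite !in_itv /= => /andP[sx ->].
  by rewrite (le_trans (ltW s0)) // ltW.
pose L := f 1 - J 1.
have fL t : 0 < t -> f t = L + J t.
  move=> t0; rewrite /L; have [t1|/ltW t1] := leP t 1.
    by have := JB t 1 t0 t1; lra.
  by have := JB 1 t ltr01 t1; lra.
exists L; last by move=> t t0; rewrite fint1E //; exact: fL.
have C : L + J s @[s --> 0^'+] --> L + 0.
  apply: cvgD; first exact: cvg_cst.
  apply: cvg_at_right_filter.
  exact: (parameterized_integral_cvg_left ltr01 (locint_integrable _ 1 lw)).
rewrite addr0 in C; apply: cvg_trans C; apply: near_eq_cvg.
by near=> s; apply/esym/fL; near: s; exact: nbhs_right_gt.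
Unshelve. all: by end_near. Qed.

(** For [a <= 1] the kernel is at least [t^(a-1)] on []0, t[], so integrability against it implies
    integrability. This is how a Caputo derivative controls the ordinary derivative near 0. *)
Lemma kintegrable_locint (a : R) (w : R -> R) : 0 < a <= 1 ->
  (forall t : R, 0 < t -> kintegrable a (pos_part w) t) -> locally_integrable_pos (pos_part w).
Proof.
move=> /andP[a0 a1] wi; set W := pos_part w.
have kk (t x : R) : x < t -> kpow (2 - a) (t - x) * kint a W t x = W x.
  move=> xt; have tx : 0 < t - x by rewrite subr_gt0.
  rewrite /kint !kpow_gt0E // mulrA -powRDgt0 //.
  by have -> : 2 - a - 1 + (a - 1) = 0 by [ring]; rewrite powRr0 mul1r.
(* The hypothesis gives measurability of the products with the kernel; multiplying by the inverse
   kernel and letting the end point grow recovers [W]. *)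
have mW : measurable_fun [set: R] W.
  pose h n x := kpow (2 - a) (n.+1%:R - x) * kint a W n.+1%:R x.
  apply: (@measurable_fun_cvg _ _ _ _ (fun n => h n)).
    move=> n; apply: measurable_funM; first exact: measurable_kpow_sub.
    by have /measurable_int /measurable_EFinP := wi n.+1%:R (ltr0Sn _ n).
  move=> x _; apply: cvg_near_cst.
  near=> n; apply: kk; apply: (@lt_trans _ _ n%:R); last by rewrite ltr_nat.
  by near: n; exact: nbhs_infty_gtr.
split => //; first by move=> x x0; rewrite /W pos_part_le0.
move=> t; have [t0|t0] := leP t 0; first exact: kintegrable_le0.
have := integrableZl measurableT (t `^ (1 - a)) (wi t t0).
apply: le_integrable => //.
  by apply/measurable_EFinP; exact: measurable_kint.
move=> x _; rewrite /= lee_fin.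
have [tx|xt] := leP t x; first by rewrite !kint_ge // normr0 mulr0 normr0.
have [x0|x0] := leP x 0; first by rewrite /kint /W pos_part_le0 // !mulr0 normr0.
have tx : 0 < t - x by rewrite subr_gt0.
rewrite /kint kpow1 tx mul1r mulrA normrM ler_peMl // ger0_norm ?mulr_ge0 ?powR_ge0 ?kpow_ge0 //.
rewrite kpow_gt0E // (@le_trans _ _ ((t - x) `^ (1 - a) * (t - x) `^ (a - 1))) //.
  by rewrite -powRDgt0 // addrA subrK subrr powRr0.
rewrite ler_wpM2r ?powR_ge0 // ge0_ler_powR ?nnegrE ?subr_ge0 ?(ltW t0) ?(ltW xt) //.
by rewrite gerBl ltW.
Unshelve. all: by end_near. Qed.

Lemma bounded_locint (w : R -> R) : measurable_fun (`]0, +oo[%classic : set R) w ->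
  (forall T : R, 0 < T -> exists M, forall x : R, 0 < x <= T -> `|w x| <= M) ->
  locally_integrable_pos (pos_part w).
Proof.
move=> mw bw; set W := pos_part w.
have mW : measurable_fun [set: R] W.
  rewrite (_ : W = w \_ `]0, +oo[); last first.
    by apply/funext => x; rewrite patchE mem_setE in_itv /= andbT.
  by apply/(measurable_restrictT _ _).1.
split => //; first by move=> x x0; rewrite /W pos_part_le0.
move=> t; have [t0|t0] := leP t 0; first exact: kintegrable_le0.
have [M HM] := bw t t0.
have i1 : mu.-integrable [set: R] ((fun=> 1%:E) \_ (`]0, t]%classic : set R)).
  by apply: iffLR (integrable_cst_itv 0 t 1); exact: integrable_mkcond.
have := integrableZl measurableT M i1.
apply: le_integrable => //.
  by apply/measurable_EFinP; exact: measurable_kint.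
move=> x _; rewrite /= patchE mem_setE in_itv /= /kint /W /pos_part kpow1 subr_gt0.
have [x0|x0] := ltP 0 x; last by rewrite mulr0 normr0 abse_ge0.
have [xt|xt] := ltP x t; last by rewrite mul0r normr0 abse_ge0.
rewrite mul1r (ltW xt) mule1 /= lee_fin (le_trans _ (ler_norm _)) //.
by apply: HM; rewrite x0 ltW.
Qed.

End half_line_FTC.

(** * Uniqueness: reduction of the equation to a Volterra equation *)

Lemma fint_comp (R : realType) (a b c : R) (f : R -> R) (t : R) : 0 < a -> 0 < b -> c = a + b ->
  measurable_fun setT f -> (forall x, kintegrable b f x) -> kintegrable c f t ->
  fint a (fint b f) t = fint c f t.
Proof. by move=> a0 b0 -> mf fi fc; have [] := kint_semigroup _ _ _ _ a0 b0 mf (fun x _ => fi x) fc. Qed.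

Section uniqueness.
Context {R : realType}.
Local Notation mu := (@lebesgue_measure R).
Variables (lambda nu u : R) (G : R -> R).
Hypotheses (nu01 : 0 < nu <= 1) (sG : is_solution lambda nu u G).

Let nu0 : 0 < nu. Proof. by have /andP[] := nu01. Qed.

Local Notation W k := (pos_part (derive1n k G)).

(** The integer hidden in [is_caputo] is determined by the order, which also excludes the branch of
    integer order. *)
Lemma caputo_frac (f : R -> R) (alpha t v : R) (m : nat) : m%:R - 1 < alpha < m%:R ->
  is_caputo alpha f t v ->
  [/\ forall (i : nat) (s : R), (i < m)%N -> 0 < s < t -> derivable (derive1n i f) s 1,
     kintegrable (m%:R - alpha) (pos_part (derive1n m f)) t &
     v = fint (m%:R - alpha) (pos_part (derive1n m f)) t].
Proof.
move=> /andP[ma am] [[k [/andP[ka ak] dk ik vk]]|[k [ak _ _]]]; last first.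
  exfalso; move: ma am; rewrite ak ltrBlDr natr1 !ltr_nat ltnS => mk km.
  by have := leq_trans km mk; rewrite ltnn.
have mk : m = k.
  have mk1 : (m < k.+1)%N by rewrite -(ltr_nat R) -natr1 -ltrBlDr (lt_trans ma ak).
  have km1 : (k < m.+1)%N by rewrite -(ltr_nat R) -natr1 -ltrBlDr (lt_trans ka am).
  by apply/eqP; rewrite eqn_leq; apply/andP; split.
rewrite {}mk; split => //; first exact/caputo_integrable.
by rewrite vk caputo_integral.
Qed.

Lemma eq_pos_part (f h : R -> R) : (forall s : R, s <= 0 -> h s = 0) ->
  (forall s : R, 0 < s -> f s = h s) -> pos_part f = h.
Proof.
move=> h0 fh; apply/funext => s; rewrite /pos_part.
by case: ltP => s0; [exact: fh|rewrite h0].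
Qed.

Lemma caputo_nat (f : R -> R) (alpha t v : R) (m : nat) : alpha = m%:R ->
  is_caputo alpha f t v ->
  (\forall s \near t, forall i : nat, (i < m)%N -> derivable (derive1n i f) s 1) /\
  v = derive1n m f t.
Proof.
move=> am [[k [/andP[ka ak] _ _ _]]|[k [ak dk vk]]].
  exfalso; move: ka ak; rewrite am ltrBlDr natr1 !ltr_nat ltnS => km mk.
  by have := leq_trans mk km; rewrite ltnn.
by have /eqP := ak; rewrite am eqr_nat => /eqP ->.
Qed.

Lemma solution_derivable1 s : 0 < s -> derivable G s 1.
Proof.
move=> s0; have [_ H _ _] := sG; have /andP[_] := nu01; rewrite le_eqVlt => /predU1P[nu1|nu1].
  have [a [b [_ cb _]]] := H s s0.
  have [] := caputo_nat _ _ _ _ 1%N nu1 cb.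
  by move=> /nbhs_singleton /(_ 0%N isT).
(* A Caputo derivative of fractional order at [t] gives derivability strictly below [t], hence its
   use at [s + 1]. *)
have s1 : 0 < s + 1 by rewrite addr_gt0.
have [a [b [_ cb _]]] := H _ s1.
have [|d _ _] := caputo_frac _ _ _ _ 1%N _ cb; first by rewrite subrr nu0.
by apply: (d 0%N) => //; rewrite s0 ltrDl ltr01.
Qed.

Lemma solution_derivable2 s : 1 < 2 * nu -> 0 < s -> derivable (derive1n 1 G) s 1.
Proof.
move=> nu2 s0; have [_ H _ _] := sG; have /andP[_] := nu01; rewrite le_eqVlt => /predU1P[nu1|nu1].
  have [a [b [ca _ _]]] := H s s0.
  have nu22 : 2 * nu = 2%:R by rewrite nu1 mulr1.
  have [] := caputo_nat _ _ _ _ 2%N nu22 ca.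
  by move=> /nbhs_singleton /(_ 1%N isT).
have s1 : 0 < s + 1 by rewrite addr_gt0.
have [a [b [ca _ _]]] := H _ s1.
have [|d _ _] := caputo_frac _ _ _ _ 2%N _ ca; first by apply/andP; split; lra.
by apply: (d 1%N) => //; rewrite s0 ltrDl ltr01.
Qed.

Let q := lambda ^+ 2 * (1 - u).

Lemma is_derive_derivable (f : R -> R) s : derivable f s 1 -> is_derive s 1 f (derive1 f s).
Proof. by move=> df; rewrite derive1E; exact: DeriveDef. Qed.

Lemma continuous_pos_measurable (f : R -> R) : (forall s : R, 0 < s -> derivable f s 1) ->
  measurable_fun (`]0, +oo[%classic : set R) f.
Proof.
move=> df; apply: open_continuous_measurable_fun => //.
move=> s; rewrite inE /= in_itv /= andbT => s0.
by apply: differentiable_continuous; apply/derivable1_diffP; exact: df.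
Qed.

Lemma solution_bounded (T : R) : 0 < T -> exists2 M, 0 <= M & forall x : R, 0 <= x <= T -> `|G x| <= M.
Proof.
move=> T0; have [cG _ _ _] := sG.
have cGT : {within `[0, T], continuous (fun x => `|G x|)}.
  have cGT : {within `[0, T], continuous G}.
    by apply: continuous_subspaceW cG => x /=; rewrite !in_itv /= andbT => /andP[].
  by move=> x; apply: cvg_norm; exact: cGT.
have [c _ Hc] := EVT_max (ltW T0) cGT.
by exists `|G c| => // x xT; apply: Hc; rewrite in_itv.
Qed.

(* For [nu = 1] the derivative of [G' + 2 lambda G] is [- q G], bounded near 0. *)
Lemma solution_locint_classical : nu = 1 ->
  locally_integrable_pos (W 1) /\ locally_integrable_pos (W 2).
Proof.
move=> nu1; have [_ H _ _] := sG.
have nu2 : 1 < 2 * nu by rewrite nu1 mulr1 ltr1n.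
have d1 := solution_derivable1.
have d2 s := solution_derivable2 s nu2.
have E s : 0 < s -> derive1n 2 G s = - q * G s - 2 * lambda * derive1n 1 G s.
  move=> s0; have [a [b [ca cb]]] := H s s0.
  have nu22 : 2 * nu = 2%:R by rewrite nu1 mulr1.
  have [_ ->] := caputo_nat _ _ _ _ 2%N nu22 ca.
  have [_ ->] := caputo_nat _ _ _ _ 1%N nu1 cb.
  by rewrite /q; lra.
pose F s := derive1n 1 G s + 2 * lambda * G s.
have dF (s : R) : 0 < s -> is_derive s 1 F (- q * G s).
  move=> s0.
  have D1 := is_derive_derivable _ _ (d1 s s0); have D2 := is_derive_derivable _ _ (d2 s s0).
  rewrite -derive1nS in D2; rewrite -derive1n1 in D1.
  apply: is_derive_eq (is_deriveD D2 (is_deriveZ (2 * lambda) D1)) _.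
  rewrite E // /GRing.scale /=; ring.
have bF (T : R) : 0 < T -> exists M, forall x : R, 0 < x <= T -> `|F x| <= M.
  move=> T0; have [M M0 HM] := solution_bounded T T0.
  exists (`|F T| + `|q| * M * T) => x /andP[x0 xT].
  (* The mean value theorem between [x] and the fixed point [T] bounds [F] uniformly as [x]
     approaches 0. *)
  have [c|  |c] := @MVT_segment _ F (fun s => - q * G s) x T xT.
  - by rewrite in_itv /= => /andP[xc _]; apply: dF; exact: lt_trans xc.
  - apply: derivable_within_continuous => c; rewrite in_itv /= => /andP[xc _].
      by have [] := dF c (lt_le_trans x0 xc).
  rewrite in_itv /= => /andP[xc cT] FE.
  have -> : F x = F T - (- q * G c) * (T - x) by rewrite -FE opprB addrC subrK.
  apply: le_trans (ler_normB _ _) _.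
  rewrite lerD2l (normrM (- q * G c)) (normrM (- q)) normrN.
  apply: ler_pM; rewrite ?mulr_ge0 //.
    by apply: ler_wpM2l => //; apply: HM; rewrite (le_trans (ltW x0) xc) cT.
  by rewrite ger0_norm ?subr_ge0 // gerBl ltW.
have b1 (T : R) : 0 < T -> exists M, forall x : R, 0 < x <= T -> `|derive1n 1 G x| <= M.
  move=> T0; have [M M0 HM] := solution_bounded T T0; have [M' HM'] := bF T T0.
  exists (M' + `|2 * lambda| * M) => x xT.
  have -> : derive1n 1 G x = F x - 2 * lambda * G x by rewrite /F addrK.
  apply: le_trans (ler_normB _ _) _; rewrite lerD ?HM' // normrM ler_wpM2l // HM //.
  by have /andP[/ltW -> ->] := xT.
have m1 := continuous_pos_measurable _ d2; have m0 := continuous_pos_measurable _ d1.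
split; first exact: bounded_locint.
apply: bounded_locint.
  apply: (@eq_measurable_fun _ _ _ _ _ (fun s => - q * G s - 2 * lambda * derive1n 1 G s)).
    by move=> s; rewrite inE /= in_itv /= andbT => s0; exact/esym/E.
  by apply: measurable_funB; apply: measurable_funM => //; exact: measurable_cst.
move=> T T0; have [M M0 HM] := solution_bounded T T0; have [M' HM'] := b1 T T0.
exists (`|q| * M + `|2 * lambda| * M') => x xT; have /andP[x0 xT'] := xT.
rewrite E //; apply: le_trans (ler_normB _ _) _.
by rewrite !(normrM _ (G x)) normrM normrN lerD ?ler_wpM2l ?HM ?HM' ?(ltW x0).
Qed.

Lemma solution_locint1 : locally_integrable_pos (W 1).
Proof.
have [_ H _ _] := sG; have /andP[_] := nu01; rewrite le_eqVlt => /predU1P[nu1|nu1].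
  by have [] := solution_locint_classical nu1.
apply: (kintegrable_locint (1 - nu)); first by rewrite subr_gt0 nu1 gerBl ltW.
move=> t t0; have [a [b [_ cb _]]] := H _ t0.
by have [|_ ik _] := caputo_frac _ _ _ _ 1%N _ cb; first by rewrite subrr nu0.
Qed.

Lemma solution_locint2 : 1 < 2 * nu -> locally_integrable_pos (W 2).
Proof.
move=> nu2; have [_ H _ _] := sG; have /andP[_] := nu01; rewrite le_eqVlt => /predU1P[nu1|nu1].
  by have [] := solution_locint_classical nu1.
apply: (kintegrable_locint (2 - 2 * nu)); first by apply/andP; split; lra.
move=> t t0; have [a [b [ca _ _]]] := H _ t0.
by have [|_ ik _] := caputo_frac _ _ _ _ 2%N _ ca; first by apply/andP; split; lra.
Qed.

Lemma solution_integral1 : pos_part (fun t => G t - 1) = fint 1 (W 1).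
Proof.
have [cG _ G0 _] := sG.
have [t t0|L GL GE] := half_line_FTC G (derive1n 1 G) _ solution_locint1.
  by rewrite derive1n1; apply: is_derive_derivable; exact: solution_derivable1.
have L1 : L = 1.
  have [_ G0L] := (continuous_within_itvcyP _ _).1 cG.
  by rewrite -G0; apply: cvg_unique GL G0L.
apply/funext => t; have [t0|t0] := leP t 0; first by rewrite pos_part_le0 // fint_le0.
by rewrite pos_part_gt0 // GE // L1; ring.
Qed.

(** The derivative has a limit [L] at 0; by the mean value theorem the difference quotient at 0
    tends to the same [L], which the additional condition makes 0. *)
Lemma solution_integral2 : 1 < 2 * nu -> W 1 = fint 1 (W 2).
Proof.
move=> nu2; have [cG _ G0 G'0] := sG.
have [t t0|L GL GE] := half_line_FTC (derive1n 1 G) (derive1n 2 G) _ (solution_locint2 nu2).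
  by rewrite derive1nS; apply: is_derive_derivable; exact: solution_derivable2.
suff L0 : L = 0.
  apply/funext => t; have [t0|t0] := leP t 0; first by rewrite pos_part_le0 // fint_le0.
  by rewrite pos_part_gt0 // GE // L0 add0r.
have {}G'0 : h^-1 * (G h - G 0) @[h --> 0^'+] --> 0 by apply: G'0; lra.
suff : h^-1 * (G h - G 0) @[h --> 0^'+] --> L by move=> GL'; apply: cvg_unique GL' G'0.
apply/cvgrPdist_le => /= e e0.
move/cvgrPdist_le : GL => /(_ e e0) [d /= d0 Hd].
exists d => //= h hd h0.
have hG : {within `[0, h], continuous G}.
  by apply: continuous_subspaceW cG => x /=; rewrite !in_itv /= andbT => /andP[].
have [c|c] := @MVT _ G (derive1n 1 G) 0 h h0 _ hG.
  rewrite in_itv /= => /andP[c0 _].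
  by rewrite ?derive1n1; apply: is_derive_derivable; exact: solution_derivable1.
rewrite in_itv /= => /andP[c0 ch] ->.
rewrite subr0 mulrC mulfK ?gt_eqF //.
apply: Hd => //; rewrite /= sub0r normrN gtr0_norm // (lt_trans ch) //.
by move: hd; rewrite /ball_ /= sub0r normrN gtr0_norm.
Qed.

(** The integral of order [2 nu] is applied to the whole equation: it turns the derivative of order
    [2 nu] into [G - 1] and the one of order [nu] into the integral of order [nu] of [G - 1]. *)
Lemma solution_volterra t : 0 < t ->
  [/\ kintegrable nu (pos_part (fun x => G x - 1)) t,
      kintegrable (2 * nu) (pos_part (fun x => q * G x)) t &
      G t - 1 + 2 * lambda * fint nu (pos_part (fun x => G x - 1)) t
        + fint (2 * nu) (pos_part (fun x => q * G x)) t = 0].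
Proof.
move=> t0; have [_ H _ _] := sG.
have /andP[_ nu1] := nu01; have nu20 : 0 < 2 * nu by rewrite mulr_gt0.
have l1 := solution_locint1; have [m1 _ k1] := l1.
have [nui nuE] : kintegrable nu (pos_part (fun x => G x - 1)) t /\
    fint nu (pos_part (fun x => G x - 1)) t = fint (nu + 1) (W 1) t.
  rewrite solution_integral1; apply: kint_semigroup => //.
  by apply: locint_kintegrable => //; lra.
(* Choice makes functions of time out of the pointwise values of the two Caputo derivatives, so that
   they can be integrated. *)
have /choice[ab Hab] : forall s, exists ab : R * R, 0 < s ->
    [/\ is_caputo (2 * nu) G s ab.1, is_caputo nu G s ab.2 &
        ab.1 + 2 * lambda * ab.2 = lambda ^+ 2 * (u - 1) * G s].
  move=> s; have [s0|s0] := leP s 0; first by exists (0, 0).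
  by have [a [b ?]] := H s s0; exists (a, b).
pose a s := (ab s).1; pose b s := (ab s).2.
(* For [nu < 1], [b = I^(1-nu) G'], hence [I^(2 nu) b = I^(nu+1) G' = I^nu (G - 1)]; for [nu = 1],
   [b] is [G'] itself. *)
have [bi bE] : kintegrable (2 * nu) (pos_part b) t /\
    fint (2 * nu) (pos_part b) t = fint nu (pos_part (fun x => G x - 1)) t.
  rewrite nuE; have [nu1'|nu1'] := eqVneq nu 1.
    have -> : pos_part b = W 1.
      apply: eq_pos_part => s s0; first exact: pos_part_le0.
      rewrite pos_part_gt0; last exact: s0.
      have [_ cb _] := Hab s s0.
      by have [_] := caputo_nat _ _ _ _ 1%N nu1' cb.
    split; first by apply: locint_kintegrable => //; lra.
    by have -> : 2 * nu = nu + 1 by rewrite nu1'; lra.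
  have nu1lt : nu < 1 by rewrite lt_neqAle nu1'.
  have nuI : 1%:R - 1 < nu < 1%:R by rewrite subrr nu0.
  have -> : pos_part b = fint (1 - nu) (W 1).
    apply: eq_pos_part => s s0; first exact: fint_le0.
    have [_ cb _] := Hab s s0.
    by have [_ _] := caputo_frac _ _ _ _ 1%N nuI cb.
  have -> : nu + 1 = 2 * nu + (1 - nu) by ring.
  apply: kint_semigroup => //; first by lra.
    move=> x _; have [x0|x0] := leP x 0; first exact: kintegrable_le0.
    have [_ cb _] := Hab x x0.
    by have [_ ik _] := caputo_frac _ _ _ _ 1%N nuI cb.
  by apply: locint_kintegrable => //; lra.
(* According as [2 nu] is below 1, equal to 1, strictly between 1 and 2, or equal to 2, [a] is
   [I^(1-2nu) G'], [G'], [I^(2-2nu) G''] or [G'']. So [I^(2 nu) a] is [I^1 G'] or [I^2 G''], both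
   equal to [G - 1]. *)
have [ai aE] : kintegrable (2 * nu) (pos_part a) t /\ fint (2 * nu) (pos_part a) t = G t - 1.
  have E1 : G t - 1 = fint 1 (W 1) t by rewrite -solution_integral1 pos_part_gt0.
  rewrite E1.
  have [nu2|nu2] := leP (2 * nu) 1.
    have [nu2'|nu2'] := eqVneq (2 * nu) 1.
      have -> : pos_part a = W 1.
        apply: eq_pos_part => s s0; first exact: pos_part_le0.
        rewrite pos_part_gt0; last exact: s0.
        have [ca _ _] := Hab s s0.
        by have [_] := caputo_nat _ _ _ _ 1%N nu2' ca.
      by rewrite nu2'; split.
    have nuI : 1%:R - 1 < 2 * nu < 1%:R by rewrite subrr nu20 lt_neqAle nu2'.
    have -> : pos_part a = fint (1 - 2 * nu) (W 1).
      apply: eq_pos_part => s s0; first exact: fint_le0.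
      have [ca _ _] := Hab s s0.
      by have [_ _] := caputo_frac _ _ _ _ 1%N nuI ca.
    have nuI' : 0 < 1 - 2 * nu by have /andP[_ +] := nuI; lra.
    have := @kint_semigroup _ (2 * nu) (1 - 2 * nu) (W 1) t nu20 nuI' m1.
    have -> : 2 * nu + (1 - 2 * nu) = 1 by rewrite addrC subrK.
    apply => //; move=> x _; have [x0|x0] := leP x 0; first exact: kintegrable_le0.
    have [ca _ _] := Hab x x0.
    by have [_ ik _] := caputo_frac _ _ _ _ 1%N nuI ca.
  have l2 := solution_locint2 nu2; have [m2 _ k2] := l2.
  have E2 : fint 1 (W 1) t = fint 2 (W 2) t.
    rewrite (solution_integral2 nu2).
    have e2 : 2 = 1 + 1 :> R by lra.
    by apply: (fint_comp _ _ _ _ _ _ ltr01 ltr01 e2 m2 k2); apply: locint_kintegrable; [lra|exact: l2].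
  rewrite E2; have [nu1'|nu1'] := eqVneq nu 1.
    have nu22 : 2 * nu = 2%:R by rewrite nu1' mulr1.
    have -> : pos_part a = W 2.
      apply: eq_pos_part => s s0; first exact: pos_part_le0.
      rewrite pos_part_gt0; last exact: s0.
      have [ca _ _] := Hab s s0.
      by have [_] := caputo_nat _ _ _ _ 2%N nu22 ca.
    rewrite nu22; split; last exact: erefl.
    by apply: locint_kintegrable; [rewrite ler1n|exact: l2].
  have nu1lt : nu < 1 by rewrite lt_neqAle nu1'.
  have nuI : 2%:R - 1 < 2 * nu < 2%:R by clear E2; apply/andP; split; lra.
  have -> : pos_part a = fint (2 - 2 * nu) (W 2).
    apply: eq_pos_part => s s0; first exact: fint_le0.
    have [ca _ _] := Hab s s0.
    by have [_ _] := caputo_frac _ _ _ _ 2%N nuI ca.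
  have nuI' : 0 < 2 - 2 * nu by clear E2; lra.
  have := @kint_semigroup _ (2 * nu) (2 - 2 * nu) (W 2) t nu20 nuI' m2.
  have -> : 2 * nu + (2 - 2 * nu) = 2 by rewrite addrC subrK.
  apply; last by apply: locint_kintegrable; [rewrite ler1n|exact: l2].
  move=> x _; have [x0|x0] := leP x 0; first exact: kintegrable_le0.
  have [ca _ _] := Hab x x0.
  by have [_ ik _] := caputo_frac _ _ _ _ 2%N nuI ca.
have qE : pos_part (fun x => q * G x) = (fun x => - 1 * (pos_part a \+ (fun x => 2 * lambda * pos_part b x)) x).
  apply/funext => s /=; rewrite /pos_part; case: ifP => s0; last by rewrite mulr0 addr0 mulr0.
  by have [_ _ E] := Hab s s0; rewrite /a /b E /q; ring.
have lbi := kintegrableZ _ (2 * lambda) _ _ bi.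
have abi := kintegrableD _ _ _ _ ai lbi.
split => //; first by rewrite qE; exact: kintegrableZ.
by rewrite qE fintZ // fintD // fintZ // aE bE; ring.
Qed.

End uniqueness.

(** The Volterra equation is affine in [G], so the difference of two solutions satisfies its
    homogeneous form; [u <= 1] gives the sign [q >= 0] that the contraction argument uses. *)
Lemma solution_unique (R : realType) (lambda nu u : R) (G1 G2 : R -> R) :
  0 < lambda -> 0 < nu <= 1 -> u <= 1 ->
  is_solution lambda nu u G1 -> is_solution lambda nu u G2 ->
  forall t : R, 0 <= t -> G1 t = G2 t.
Proof.
move=> lambda0 nu01 u1 s1 s2 t t0; have /andP[nu0 nu1] := nu01.
have V1 := @solution_volterra R lambda nu u G1 nu01 s1.
have V2 := @solution_volterra R lambda nu u G2 nu01 s2.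
have [c1 _ G10 _] := s1; have [c2 _ G20 _] := s2.
set q := lambda ^+ 2 * (1 - u) in V1 V2.
have q0 : 0 <= q by rewrite mulr_ge0 ?sqr_ge0 // subr_ge0.
pose H x := G1 x - G2 x.
have HE : pos_part H = pos_part (fun x => G1 x - 1) \+ (fun x => -1 * pos_part (fun x => G2 x - 1) x).
  by apply/funext => x; rewrite /= /pos_part /H; case: ifP => _; ring.
have qHE : pos_part (fun x => q * H x) =
    pos_part (fun x => q * G1 x) \+ (fun x => -1 * pos_part (fun x => q * G2 x) x).
  by apply/funext => x; rewrite /= /pos_part /H; case: ifP => _; ring.
apply/eqP; rewrite -subr_eq0; apply/eqP; rewrite -/(H t).
apply: (@volterra_unique _ nu (2 * nu) (2 * lambda) q H) => //.
- by rewrite mulr_gt0.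
- by rewrite mulr_ge0 // ltW.
- by move=> x; apply: cvgB; [exact: c1|exact: c2].
- by rewrite /H G10 G20 subrr.
- move=> s s0; have [i1 _ _] := V1 s s0; have [i2 _ _] := V2 s s0.
  by rewrite HE; apply: kintegrableD => //; exact: kintegrableZ.
- move=> s s0; have [_ i1 _] := V1 s s0; have [_ i2 _] := V2 s s0.
  by rewrite qHE; apply: kintegrableD => //; exact: kintegrableZ.
- move=> s s0; have [i1 j1 E1] := V1 s s0; have [i2 j2 E2] := V2 s s0.
  rewrite HE qHE !fintD //; try exact: kintegrableZ.
  by rewrite !fintZ // /H; lra.
Qed.

Theorem theorem3p2 (R : realType) (lambda nu u : R)
    (hlambda : 0 < lambda) (hnu : 0 < nu <= 1) (hu : 0 < u <= 1) :
  [/\ forall t : R, 0 <= t -> cvgn (Ghat_series lambda nu u t),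
      is_solution lambda nu u (Ghat lambda nu u),
      forall G : R -> R, is_solution lambda nu u G ->
        forall t : R, 0 <= t -> G t = Ghat lambda nu u t &
      forall t : R, 0 <= t ->
        Ghat lambda nu u t =
          (Num.sqrt u + 1) / (2 * Num.sqrt u) *
            mittag_leffler nu 1 (- lambda * (1 - Num.sqrt u) * t `^ nu) +
          (Num.sqrt u - 1) / (2 * Num.sqrt u) *
            mittag_leffler nu 1 (- lambda * (1 + Num.sqrt u) * t `^ nu)].
Proof.
have /andP[u0 u1] := hu; have /andP[nu0 _] := hnu.
set v := Num.sqrt u.
have v01 : 0 < v <= 1 by rewrite sqrtr_gt0 u0 -sqrtr1 ler_sqrt.
have <- : v ^+ 2 = u by rewrite sqr_sqrtr // ltW.
have sol := Ghat_is_solution lambda nu v hlambda hnu v01.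
split=> [t _||G sG|t _].
- by apply/cvg_ex; eexists; exact: Ghat_series_cvg.
- exact: sol.
- apply: solution_unique hlambda hnu _ sG sol.
  by rewrite sqr_sqrtr // ltW.
- by rewrite GhatE // rpsum0E gf_series_mittag_leffler.
Qed.
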